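(* Suppose player $A$'s payoffs lie in $[0,H]$ and $m<T$. The odd/even block algorithm described in the context guarantees a $1/2$-approximation for player $A$'s expected cumulative payoff against the memory-limited count-based learning rule $f_m$ (that is, expected cumulative payoff at least $\tfrac12\mathrm{OPT}$), in time $O\big(k_Bk_A^3(m+2k_A)^{2k_A}\big)$.
   Context: Setting. A two-player normal-form game is repeated for $T$ rounds. Player $A$ (the optimizer) has actions $\mathcal{A}=\{a_1,\dots,a_{k_A}\}$, player $B$ (the opponent) has actions $\mathcal{B}=\{b_1,\dots,b_{k_B}\}$, with utilities $u^A,u^B:\mathcal{A}\times\mathcal{B}\to\mathbb{R}$. For $a\in\mathcal{A}$ and $\beta\in\Delta(\mathcal{B})$ (mixed actions of $B$), $\bar u^A(a,\beta)=\sum_{j=1}^{k_B}\beta(b_j)u^A(a,b_j)$. A memory-limited count-based learning rule $f_m$ with memory $m$ maps count vectors $(c_1,\dots,c_{k_A})\in\mathbb{N}^{k_A}$ to $\Delta(\mathcal{B})$: in round $t$, player $B$ plays $f_m(c_1,\dots,c_{k_A})$, where $c_i$ is the number of times $A$ played $a_i$ in the last $\min(m,t-1)$ rounds. For a list of actions, $f_m([x_1,\dots,x_j])$ means $f_m$ applied to the counts of the listed actions. The output of $f_m$ on given counts is assumed to be computable in $O(k_Ak_B)$ time. The expected cumulative payoff of $x_1,\dots,x_T\in\mathcal{A}$ is $\sum_{t=1}^T\bar u^A(x_t,f_m([x_{\max(1,t-m)},\dots,x_{t-1}]))$, and $\mathrm{OPT}$ is its maximum over $\mathcal{A}^T$.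 The algorithm (input: $f_m$, $m$, $\mathcal{A}$, $\mathcal{B}$, $T$; output: an action sequence for $A$). 1. Divide the time horizon into blocks of size $m$, except for the last block, which has size $p=T \bmod m$. 2. Compute by dynamic programming: $S_m$, a sequence maximizing $A$'s expected payoff in the first $m$ time steps; $S_{2m}$, a sequence of length $2m$ maximizing $A$'s expected payoff in its last $m$ time steps; $S_{m+p}$, a sequence of length $m+p$ maximizing $A$'s expected payoff in its last $p$ time steps. 3. Consider the following two strategies and play the one with higher expected payoff. Odd strategy: play $S_m$, then repeatedly play $S_{2m}$; if a block of length $m+p$ remains, play $S_{m+p}$; otherwise play arbitrary actions until time $T$. Even strategy: repeatedly play $S_{2m}$; if a block of length $m+p$ remains, play $S_{m+p}$; otherwise play arbitrary actions until time $T$. Dynamic programs. Let $e_i$ be the $i$-th unit vector. For $S_m$: for count vectors $c$ with $1\le\sum_ic_i\le m$, $V[e_i]=\bar u^A(a_i,f_m(0,\dots,0))$ and, when $\sum_i c_i\ge2$, $V[c]=\max_{i:c_i\ge1}\big(V[c-e_i]+\bar u^A(a_i,f_m(c-e_i))\big)$; take the best entry with $\sum_ic_i=m$. For $S_{2m}$ and $S_{m+p}$: $V[c][c']$ is indexed by count vectors with $\sum_ic_i+\sum_ic'_i=m$; it is the maximum expected payoff of $A$ in the interval $(m,m+\sum_ic'_i]$ when each $a_i$ is played $c_i$ times in the interval $(m-\sum_ic_i,m]$ and $c'_i$ times in $(m,m+\sum_ic'_i]$. Initialize $V[c][0]=0$ for $\sum_ic_i=m$, and for $\sum_i c'_i\ge1$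 set $V[c][c']=\max_{(i,j)\in[k_A]^2,\,c'_j\ge1}\big(V[c+e_i][c'-e_j]+\bar u^A(a_j,f_m(c+c'+e_i-e_j))\big)$. The optimum for $S_{2m}$ is $\max_{\sum_ic'_i=m}V[0][c']$ and for $S_{m+p}$ it is $\max_{\sum_ic_i=m-p,\ \sum_ic'_i=p}V[c][c']$; the sequences are recovered by backtracking. *)

(* Defs.v *)
From mathcomp Require Import all_boot all_order all_algebra.
From mathcomp Require Import reals.

Set Implicit Arguments.
Unset Strict Implicit.
Unset Printing Implicit Defensive.

Import Order.TTheory GRing.Theory Num.Theory.
Local Open Scope ring_scope.

(** * Game, learning rule, payoff *)

Record game (R : realFieldType) (kA kB : nat) := Game {
  utilA : 'I_kA -> 'I_kB -> R;
  utilB : 'I_kA -> 'I_kB -> R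
}.

Record mixed (R : realFieldType) (k : nat) := Mixed {
  weight :> {ffun 'I_k -> R};
  mixed_ge0 : forall j, 0 <= weight j;
  mixed_sum1 : \sum_j weight j = 1
}.

Definition countvec (k : nat) := {ffun 'I_k -> nat}.

Definition csum k (c : countvec k) : nat := (\sum_i c i)%N.
Definition counts k (s : seq 'I_k) : countvec k := [ffun i => count_mem i s].

Definition ubar (R : realFieldType) kA kB (G : game R kA kB)
    (a : 'I_kA) (beta : mixed R kB) : R :=
  \sum_(j < kB) beta j * utilA G a j.

(* Rounds are numbered from 0, so that in round t the visible actions are
   those at positions max(0, t - m), ..., t - 1. *)
Definition payoff (R : realFieldType) kA kB (G : game R kA kB)
    (fm : countvec kA -> mixed R kB) (m : nat) (x : seq 'I_kA) : R :=
  \sum_(t < size x)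
    ubar G (tnth (in_tuple x) t) (fm (counts (drop (t - m) (take t x)))).

(* The default value 0 of the maximum plays no role when kA > 0 and the
   utilities of A are nonnegative. *)
Definition OPT (R : realFieldType) kA kB (G : game R kA kB)
    (fm : countvec kA -> mixed R kB) (m T : nat) : R :=
  \big[Num.max/0]_(x : T.-tuple 'I_kA) payoff G fm m x.

(** * Cost model

  Unit-cost real RAM. A value of type [timed X] is the outcome of a computation
  together with the number of elementary steps it takes. Every piece of data is
  produced through [step n x], where [n] is the price of computing [x]:
  - arithmetic, comparison or test on numbers (reals, integers, indices),
    reading an array cell, prepending to a list: 1 each;
  - building a count vector, or reading or writing a table cell addressed by d
    integers: the number of integers involved;
  - allocating a table with d indices ranging over 0..m: (m + 1) ^ d;
  - traversing or copying a list: its length;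
  - one more unit for each iteration of a loop.
  [ret] and [bind] only sequence computations; branching on a value already
  computed is part of the price of computing it. *)

Record timed (X : Type) := Timed { result : X; time : nat }.

Definition ret X (x : X) : timed X := Timed x 0.
Definition step (n : nat) X (x : X) : timed X := Timed x n.
Definition bind X Y (a : timed X) (k : X -> timed Y) : timed Y :=
  let b := k (result a) in Timed (result b) (time a + time b).

Notation "x <-- a ;; k" := (bind a (fun x => k))
  (at level 100, a at next level, right associativity).
Notation "' p <-- a ;; k" := (bind a (fun x => match x with p => k end))
  (at level 100, p pattern, a at next level, right associativity).

Fixpoint for_each I S (xs : seq I) (body : I -> S -> timed S) (s : S)
    : timed S :=
  if xs is x :: xs' then
    s1 <-- body x s ;;
    s2 <-- step 1 s1 ;;
    for_each xs' body s2
  else step 1 s.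

(* A table is threaded linearly through the programs below, i.e. an old version
   is never read after an update, so it stands for an array updated in place.
   [None] is the content of a cell that has not been written. *)
Definition table (K E : Type) := K -> option E.

Definition talloc (K E : Type) (m d : nat) : timed (table K E) :=
  step (m.+1 ^ d)%N (fun=> None).
Definition tread (K E : Type) (d : nat) (V : table K E) (key : K)
    : timed (option E) :=
  step d (V key).
Definition twrite (K : eqType) E (d : nat) (V : table K E) (key : K)
    (e : option E) : timed (table K E) :=
  step d (fun key' => if key' == key then e else V key').

(** * Count vectors *)

Definition zerov k : countvec k := [ffun=> 0%N].
Definition incr k (c : countvec k) (i : 'I_k) : countvec k :=
  [ffun l => (c l + (l == i))%N].
Definition decr k (c : countvec k) (i : 'I_k) : countvec k :=
  [ffun l => (c l - (l == i))%N].
Definition addv k (c d : countvec k) : countvec k :=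
  [ffun l => (c l + d l)%N].
Definition vec_of_seq k (s : seq nat) : countvec k :=
  [ffun i : 'I_k => nth 0%N s i].

(* All lists of d naturals with sum s. *)
Fixpoint compositions (d s : nat) : timed (seq (seq nat)) :=
  if d is d'.+1 then
    for_each (iota 0 s.+1) (fun x acc =>
      rest <-- compositions d' (s - x) ;;
      for_each rest (fun l acc' => step 1 ((x :: l) :: acc')) acc) [::]
  else step 1 (if s == 0%N then [:: [::]] else [::]).

Definition count_vectors (k s : nat) : timed (seq (countvec k)) :=
  ls <-- compositions k s ;;
  for_each ls (fun l acc => step k.+1 (vec_of_seq k l :: acc)) [::].

(* Some list of actions with given counts. *)
Definition listing k (c : countvec k) : timed (seq 'I_k) :=
  for_each (enum 'I_k) (fun i acc => step (c i).+1 (nseq (c i) i ++ acc)) [::].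

Definition keep_best (R : realFieldType) D (best : option (R * D)) (v : R)
    (d : D) : timed (option (R * D)) :=
  step 1 (if best is Some (v', _) then if v' < v then Some (v, d) else best
          else Some (v, d)).

(** * The algorithm *)

Section Algorithm.
Variables (R : realFieldType) (kA kB : nat) (G : game R kA kB).
(* The learning rule as a procedure; the mathematical function f_m is
   [fun c => result (f c)]. *)
Variable f : countvec kA -> timed (mixed R kB).
Variable m : nat.

(* Expected payoff of action a in a round where the visible counts are c. *)
Definition round_payoff (a : 'I_kA) (c : countvec kA) : timed R :=
  beta <-- f c ;;
  for_each (enum 'I_kB) (fun j acc => step 4 (acc + beta j * utilA G a j)) 0.

(* Table for S_m: [V c] holds the value and the maximizing last action. *)
Definition prefix_table := table (countvec kA) (R * 'I_kA).

Definition prefix_cell (V : prefix_table) (s : nat) (c : countvec kA)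
    : timed (option (R * 'I_kA)) :=
  for_each (enum 'I_kA) (fun i best =>
    present <-- step 1 (0 < c i)%N ;;
    if present then
      c1 <-- step kA (decr c i) ;;
      first <-- step 1 (s == 1)%N ;;
      old <-- (if first then step 1 (Some 0)
               else e <-- tread kA V c1 ;; step 1 (omap fst e)) ;;
      if old is Some v then
        w <-- round_payoff i c1 ;;
        v' <-- step 1 (v + w) ;;
        keep_best best v' i
      else ret best
    else ret best) None.

Definition fill_prefix : timed prefix_table :=
  V0 <-- talloc (countvec kA) (R * 'I_kA) m kA ;;
  for_each (iota 1 m) (fun s V =>
    cs <-- count_vectors kA s ;;
    for_each cs (fun c V' =>
      e <-- prefix_cell V' s c ;;
      twrite kA V' c e) V) V0.

Fixpoint backtrack_prefix (V : prefix_table) (n : nat) (c : countvec kA)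
    (acc : seq 'I_kA) : timed (seq 'I_kA) :=
  if n is n'.+1 then
    e <-- tread kA V c ;;
    if e is Some (_, i) then
      c1 <-- step kA (decr c i) ;;
      acc1 <-- step 1 (i :: acc) ;;
      backtrack_prefix V n' c1 acc1
    else ret acc
  else step 1 acc.

Definition compute_Sm : timed (seq 'I_kA) :=
  V <-- fill_prefix ;;
  cs <-- count_vectors kA m ;;
  best <-- for_each cs (fun c best =>
    e <-- tread kA V c ;;
    if e is Some (v, _) then keep_best best v c else ret best) None ;;
  if best is Some (_, c) then backtrack_prefix V m c [::] else ret [::].

(* Table for S_2m and S_(m+p): [V (c, c')] holds the value and the maximizing
   pair (i, j); there is no such pair when c' = 0. *)
Definition window_table :=
  table (countvec kA * countvec kA) (R * option ('I_kA * 'I_kA)).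

Definition window_cell (V : window_table) (c c' : countvec kA)
    : timed (option (R * option ('I_kA * 'I_kA))) :=
  for_each (enum 'I_kA) (fun i =>
    for_each (enum 'I_kA) (fun j best =>
      present <-- step 1 (0 < c' j)%N ;;
      if present then
        c1 <-- step kA (incr c i) ;;
        c1' <-- step kA (decr c' j) ;;
        old <-- tread (2 * kA) V (c1, c1') ;;
        if old is Some (v, _) then
          visible <-- step (3 * kA) (decr (incr (addv c c') i) j) ;;
          w <-- round_payoff j visible ;;
          v' <-- step 1 (v + w) ;;
          keep_best best v' (Some (i, j))
        else ret best
      else ret best)) None.

Definition fill_window : timed window_table :=
  V0 <-- talloc (countvec kA * countvec kA)
           (R * option ('I_kA * 'I_kA)) m (2 * kA) ;;
  full <-- count_vectors kA m ;;
  V1 <-- for_each full (fun c V =>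
    zero <-- step kA (zerov kA) ;;
    twrite (2 * kA) V (c, zero) (Some (0, None))) V0 ;;
  for_each (iota 1 m) (fun s V =>
    cs <-- count_vectors kA (m - s) ;;
    cs' <-- count_vectors kA s ;;
    for_each cs (fun c =>
      for_each cs' (fun c' V' =>
        e <-- window_cell V' c c' ;;
        twrite (2 * kA) V' (c, c') e)) V) V1.

(* From (c, c') with sums m - n and n, recovers the actions at positions
   1..n and m+1..m+n; those at positions n+1..m are any listing of c. *)
Fixpoint backtrack_window (V : window_table) (n : nat) (c c' : countvec kA)
    (pre post : seq 'I_kA) : timed (seq 'I_kA * seq 'I_kA) :=
  if n is n'.+1 then
    e <-- tread (2 * kA) V (c, c') ;;
    if e is Some (_, Some (i, j)) then
      c1 <-- step kA (incr c i) ;;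
      c1' <-- step kA (decr c' j) ;;
      pre1 <-- step 1 (i :: pre) ;;
      post1 <-- step 1 (j :: post) ;;
      backtrack_window V n' c1 c1' pre1 post1
    else ret (pre, post)
  else step 1 (pre, post).

(* A sequence of length m + q maximizing the payoff in its last q steps:
   S_2m for q = m and S_(m+p) for q = p. *)
Definition recover_window (V : window_table) (q : nat) : timed (seq 'I_kA) :=
  cs <-- count_vectors kA (m - q) ;;
  cs' <-- count_vectors kA q ;;
  best <-- for_each cs (fun c =>
    for_each cs' (fun c' best =>
      e <-- tread (2 * kA) V (c, c') ;;
      if e is Some (v, _) then keep_best best v (c, c') else ret best)) None ;;
  if best is Some (_, (c, c')) then
    mid <-- listing c ;;
    '(pre, post) <-- backtrack_window V q c c' [::] [::] ;;
    step (size pre + size mid + size post) (pre ++ mid ++ post)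
  else ret [::].

(* Action sequences are output in run-length form: (r, b) stands for r
   consecutive copies of the block b. Writing the T actions one by one would
   take time depending on T. *)
Definition schedule := seq (nat * seq 'I_kA).

Definition expand (s : schedule) : seq 'I_kA :=
  flatten [seq flatten (nseq rb.1 rb.2) | rb <- s].

(* Payoff of the block b when h lists the last actions played (at most m of
   them), together with the list of last actions after b. *)
Definition block_payoff (h b : seq 'I_kA) : timed (R * seq 'I_kA) :=
  for_each b (fun x st =>
    let: (v, g) := st in
    c <-- step (kA + size g) (counts g) ;;
    w <-- round_payoff x c ;;
    v' <-- step 1 (v + w) ;;
    g' <-- step (size g).+1 (drop ((size g).+1 - m) (rcons g x)) ;;
    ret (v', g')) (0, h).

(* A block repeated at least twice has length at least m in the schedules
   below, so that all its copies but the first have the same payoff. *)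
Definition schedule_payoff (s : schedule) : timed R :=
  '(v, _) <-- for_each s (fun rb st =>
    let: (r, b) := rb in
    let: (v, h) := st in
    none <-- step 1 (r == 0%N) ;;
    if none then ret (v, h)
    else
      '(v1, h1) <-- block_payoff h b ;;
      '(v2, _) <-- block_payoff h1 b ;;
      v' <-- step 4 (v + v1 + (r.-1)%:R * v2) ;;
      ret (v', h1)) (0, [::]) ;;
  ret v.

(* How to fill r blocks of length m followed by p rounds; w lists the p
   arbitrary actions. *)
Definition fill_blocks (r : nat) (S2m Smp w : seq 'I_kA) : timed schedule :=
  step 4 [:: (r./2, S2m); (1%N, if odd r then Smp else w)].

Definition odd_even (T : nat) (w : seq 'I_kA) : timed schedule :=
  n <-- step 1 (T %/ m)%N ;;
  p <-- step 1 (T %% m)%N ;;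
  Sm <-- compute_Sm ;;
  V <-- fill_window ;;
  S2m <-- recover_window V m ;;
  Smp <-- recover_window V p ;;
  rest <-- fill_blocks n.-1 S2m Smp w ;;
  odd_strategy <-- step 1 ((1%N, Sm) :: rest) ;;
  even_strategy <-- fill_blocks n S2m Smp w ;;
  v_odd <-- schedule_payoff odd_strategy ;;
  v_even <-- schedule_payoff even_strategy ;;
  step 1 (if v_even <= v_odd then odd_strategy else even_strategy).

End Algorithm.

(* Main.v *)
(* A round only sees the last [m] actions, so the payoff in a block of length
   [m] is determined by that block and its predecessor, and the payoff of [S_2m]
   in its second half does not depend on when [S_2m] is played. Hence the odd
   strategy earns at least the optimum on the even-indexed blocks (the first one
   through [S_m]) and the even strategy at least the optimum on the odd-indexed
   ones, with [S_(m+p)] covering the final [p] rounds in exactly one of the two.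
   As payoffs are nonnegative, the two strategies together earn at least [OPT],
   so the better one earns half of it.

   In the window programs only the counts of the actions that remain visible
   matter, and a cell [(c, c')] with total [m] is reached by appending an action
   at position [s] and one at position [m + s]. Levels [s] contribute at most
   [(m + 1)^(kA - 1)] vectors for each of [c] and [c'], at cost [O(kA^3 kB)] per
   cell. *)

Require Import Defs.
From mathcomp Require Import all_boot all_order all_algebra.
From mathcomp Require Import reals zify ring.

Set Implicit Arguments.
Unset Strict Implicit.
Unset Printing Implicit Defensive.

Import Order.TTheory GRing.Theory Num.Theory.
Local Open Scope ring_scope.

(** * Reasoning about timed computations *)

(** A Hoare-style judgement with a time budget: correctness and running time of a program are
    established in one pass. *)
Definition runs X (a : timed X) (n : nat) (Q : X -> Prop) : Prop :=
  (time a <= n)%N /\ Q (result a).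

Lemma runs_ret X (x : X) n (Q : X -> Prop) : Q x -> runs (ret x) n Q.
Proof. by []. Qed.

Lemma runs_step X j (x : X) n (Q : X -> Prop) :
  (j <= n)%N -> Q x -> runs (step j x) n Q.
Proof. by []. Qed.

(** The first part is paid from the budget and the rest is passed on; [j <= n] keeps the truncated
    subtraction [n - j] exact. *)
Lemma runs_bind X Y j (P : X -> Prop) (a : timed X) (k : X -> timed Y) n Q :
  runs a j P -> (j <= n)%N -> (forall x, P x -> runs (k x) (n - j) Q) ->
  runs (bind a k) n Q.
Proof.
move=> [ta Pa] jn /(_ _ Pa) [tk Qk]; split=> //=.
by rewrite -(subnKC jn) leq_add.
Qed.

Lemma runs_bind_step X Y j (x : X) (k : X -> timed Y) n Q :
  (j <= n)%N -> runs (k x) (n - j) Q -> runs (bind (step j x) k) n Q.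
Proof. by move=> jn kx; apply: (@runs_bind _ _ j (eq x)) => // _ <-. Qed.

Lemma runs_weaken X (a : timed X) n n' (Q Q' : X -> Prop) :
  runs a n Q -> (n <= n')%N -> (forall x, Q x -> Q' x) -> runs a n' Q'.
Proof. by move=> [ta Qa] nn' QQ'; split; [apply: leq_trans ta nn' | apply: QQ']. Qed.

(** The invariant is indexed by the prefix already processed. Each iteration pays one unit of
    overhead besides [b], and leaving the loop pays one more. *)
Lemma runs_for_each I S (P : seq I -> S -> Prop) b (xs : seq I) body s n :
  P [::] s ->
  (forall ys x zs s', xs = ys ++ x :: zs -> P ys s' ->
     runs (body x s') b (P (rcons ys x))) ->
  (size xs * b.+1 + 1 <= n)%N ->
  runs (for_each xs body s) n (P xs).
Proof.
move=> P0 Pbody len; suff H ys zs s' : xs = ys ++ zs -> P ys s' ->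
    runs (for_each zs body s') (size zs * b.+1 + 1) (P xs).
  exact: runs_weaken (H [::] xs s erefl P0) len _.
elim: zs ys s' => [|z zs IH] ys s' def Ps'.
  by rewrite cats0 in def; rewrite def; apply: runs_step.
have zP := Pbody _ _ _ _ def Ps'.
apply: runs_bind zP _ _; first by rewrite /=; lia.
move=> s1 Ps1; apply: runs_bind_step; first by rewrite /=; lia.
apply: runs_weaken (IH (rcons ys z) s1 _ Ps1) _ _ => //.
  by rewrite cat_rcons.
by rewrite /=; lia.
Qed.

(* Merging the truncated subtractions keeps [lia] from splitting on each of them. *)
Ltac budget := rewrite -?subnDA; lia.

(** * Loops that compute a maximum *)

Section Maximization.
Variables (R : realFieldType) (D : Type).
Implicit Types (Q A : D -> R -> Prop) (best : option (R * D)).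

(** [Q d v] reads: candidate [d] has value [v]. A relation, rather than a list, lets candidates be
    described by what they mean. *)
Definition best_among Q best : Prop :=
  match best with
  | Some (v, d) => Q d v /\ forall d' v', Q d' v' -> v' <= v
  | None => forall d v, ~ Q d v
  end.

(** Quantifying over the candidates [Q] seen before makes the notion compose: a loop body, or a
    whole inner loop, adds its own [A] to whatever was there. *)
Definition contributes (body : option (R * D) -> timed (option (R * D))) n A :=
  forall best Q, best_among Q best ->
    runs (body best) n (best_among (fun d v => Q d v \/ A d v)).

Lemma best_among_ext Q Q' best :
  (forall d v, Q d v <-> Q' d v) -> best_among Q best -> best_among Q' best.
Proof.
move=> QQ'; case: best => [[v d] [Qv max]|Q0] /=.
  by split=> [|d' v' /QQ']; [apply/QQ' | apply: max].
by move=> d v /QQ'; apply: Q0.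
Qed.

Lemma contributes_none n A : (forall d v, ~ A d v) ->
  contributes (fun best => ret best) n A.
Proof.
move=> A0 best Q HQ; apply: runs_ret; apply: best_among_ext HQ => d v.
by split=> [|[]//]; [left | move/A0].
Qed.

Lemma contributes_keep_best v d n A : (0 < n)%N ->
  (forall d' v', A d' v' <-> d' = d /\ v' = v) ->
  contributes (fun best => keep_best best v d) n A.
Proof.
move=> n0 Avd best Q; have Av : A d v by apply/Avd.
case: best => [[v0 d0] [Q0 max]|Q0]; apply: runs_step => //=; last first.
  by split=> [|d' v' []]; [right | move/Q0 | move/Avd=> [_ ->]].
case: ltP => vv0; split.
- by right.
- by move=> d' v' [/max v'0|/Avd [_ ->]//]; apply: le_trans (ltW vv0).
- by left.
- by move=> d' v' [/max|/Avd [_ ->]].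
Qed.

Lemma contributes_for_each (I : eqType) (xs : seq I) body b n
    (A : I -> D -> R -> Prop) :
  (forall x, x \in xs -> contributes (body x) b (A x)) ->
  (size xs * b.+1 + 1 <= n)%N ->
  contributes (for_each xs body) n (fun d v => exists2 x, x \in xs & A x d v).
Proof.
move=> Hb len best Q HQ.
apply: (runs_for_each (b := b) (P := fun ys => best_among
  (fun d v => Q d v \/ exists2 x, x \in ys & A x d v))) => //.
  by apply: best_among_ext HQ => d v; split=> [|[//|[]//]]; left.
move=> ys x zs s' def Hs'; have xxs : x \in xs by rewrite def mem_cat mem_head orbT.
apply: runs_weaken (Hb x xxs _ _ Hs') _ _ => // best'.
apply: best_among_ext => d v.
split=> [[[|[y ys_y Ay]]|]|[|[y]]].
- by left.
- by right; exists y => //; rewrite mem_rcons inE ys_y orbT.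
- by right; exists x => //; rewrite mem_rcons mem_head.
- by left; left.
- rewrite mem_rcons inE => /orP[/eqP->|]; first by right.
  by left; right; exists y.
Qed.

Lemma runs_maximize body n A : contributes body n A ->
  runs (body None) n (best_among A).
Proof.
move=> /(_ None (fun _ _ => False)) H; apply: runs_weaken (H _) _ _ => // [d v []|best].
by apply: best_among_ext => d v; split=> [[]|]; last right.
Qed.

End Maximization.
Arguments contributes_for_each {R D I xs body} b {n} A.

(** * Count vectors *)

Section CountVectors.
Variable k : nat.
Implicit Types (c d : countvec k) (s x y : seq 'I_k) (i j : 'I_k).

Lemma counts_nil : counts [::] = zerov k.
Proof. by apply/ffunP => i; rewrite !ffunE. Qed.

Lemma counts_cons i x : counts (i :: x) = incr (counts x) i.
Proof. by apply/ffunP => j; rewrite !ffunE /= addnC [i == j]eq_sym. Qed.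

Lemma counts_cat x y : counts (x ++ y) = Defs.addv (counts x) (counts y).
Proof. by apply/ffunP => j; rewrite !ffunE count_cat. Qed.

Lemma counts_rcons x i : counts (rcons x i) = incr (counts x) i.
Proof. by apply/ffunP => j; rewrite !ffunE -cats1 count_cat /= addn0 [i == j]eq_sym. Qed.

Lemma incrK c i : decr (incr c i) i = c.
Proof. by apply/ffunP => j; rewrite !ffunE addnK. Qed.

Lemma decrK c i : (0 < c i)%N -> incr (decr c i) i = c.
Proof.
by move=> ci; apply/ffunP => j; rewrite !ffunE subnK //; case: eqP => // ->.
Qed.

Lemma incr_gt0 c i : (0 < incr c i i)%N.
Proof. by rewrite ffunE eqxx addn1. Qed.

Lemma csum_incr c i : csum (incr c i) = (csum c).+1.
Proof.
rewrite /csum (eq_bigr (fun j => (c j + (j == i))%N)) => [|j _]; last by rewrite ffunE.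
by rewrite big_split /= -big_mkcond big_pred1_eq addn1.
Qed.

Lemma csum_decr c i : (0 < c i)%N -> (csum (decr c i)).+1 = csum c.
Proof. by move=> ci; rewrite -(csum_incr _ i) decrK. Qed.

Lemma csum_addv c d : csum (Defs.addv c d) = (csum c + csum d)%N.
Proof. by rewrite /csum -big_split; apply: eq_bigr => j _; rewrite ffunE. Qed.

Lemma csum_counts x : csum (counts x) = size x.
Proof.
elim: x => [|i x IH]; last by rewrite counts_cons csum_incr IH.
by rewrite counts_nil /csum big1 // => i _; rewrite ffunE.
Qed.

Lemma csum_eq0 c : csum c = 0%N -> c = zerov k.
Proof.
move/eqP; rewrite sum_nat_eq0 => /forallP c0; apply/ffunP => i.
by rewrite ffunE; have := c0 i; move/eqP.
Qed.

(** The time is summed along the loop, which gives [csum c] for all copying; a uniform bound per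
    iteration would cost a factor [k]. *)
Lemma runs_listing c n : (csum c + 2 * k + 1 <= n)%N ->
  runs (listing c) n (fun z => counts z = c).
Proof.
move=> cn; rewrite /listing; split.
  apply: leq_trans cn; have -> : csum c = (\sum_(i <- enum 'I_k) c i)%N by rewrite big_enum.
  have H (e : seq 'I_k) acc : (time (for_each e (fun i acc =>
      step (c i).+1 (nseq (c i) i ++ acc)) acc) <=
      \sum_(i <- e) c i + 2 * size e + 1)%N.
    elim: e acc => [|i e IH] acc /=; first by rewrite big_nil.
    by rewrite big_cons; have := IH (nseq (c i) i ++ acc); lia.
  by have := H (enum 'I_k) [::]; rewrite size_enum_ord.
have H (e : seq 'I_k) acc j : count_mem j (result (for_each e (fun i acc =>
    step (c i).+1 (nseq (c i) i ++ acc)) acc)) =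
    (count_mem j acc + \sum_(i <- e | i == j) c i)%N.
  elim: e acc => [|i e IH] acc /=; first by rewrite big_nil addn0.
  rewrite IH big_cons count_cat count_nseq /=.
  by case: eqP => _; rewrite ?mul1n ?mul0n; lia.
by apply/ffunP => j; rewrite ffunE H big_enum_cond /= big_pred1_eq.
Qed.

Lemma countsP c : exists x, counts x = c.
Proof. by exists (result (listing c)); case: (runs_listing (leqnn (csum c + 2 * k + 1))). Qed.

End CountVectors.

(** * Enumeration of count vectors *)

Lemma leq_expnl a b e : (a <= b)%N -> (a ^ e <= b ^ e)%N.
Proof. by move=> ab; case: e => // e; rewrite leq_exp2r. Qed.

(* For [d > 0] a bound on, and for [d = 0] the value of, the number of lists
   produced by [compositions d s]. *)
Definition comp_bound d s := if d is d'.+1 then (s.+1 ^ d')%N else nat_of_bool (s == 0%N).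

Lemma comp_bound_le d s : (comp_bound d s <= s.+1 ^ d)%N.
Proof. by case: d => [|d] /=; [case: (s == 0%N) | exact: leq_pexp2l]. Qed.

(** For [d > 0] there are [s + 1] terms of size at most [(s + 1) ^ (d - 1)]. For [d = 0] only
    [x = s] contributes; bounding each term by 1 would give [s + 1] instead of 1. *)
Lemma sum_comp_bound d s :
  (\sum_(x <- iota 0 s.+1) comp_bound d (s - x) <= s.+1 ^ d)%N.
Proof.
case: d => [|d].
  rewrite /comp_bound (_ : iota 0 s.+1 = index_iota 0 s.+1) // big_nat_recr //= subnn eqxx big_nat big1 // => x /andP[_ xs].
  by apply/eqP; rewrite eqb0 subn_eq0 -ltnNge.
apply: (@leq_trans (\sum_(x <- iota 0 s.+1) s.+1 ^ d)%N).
  by apply: leq_sum => x _; apply: leq_expnl; lia.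
by rewrite big_const_seq count_predT size_iota iter_addn_0 expnS mulnC.
Qed.

(** For [d > 0] the last entry is forced by the others, so the number of lists is one power of
    [s + 1] below the time bound. That saved factor later absorbs the loop over levels. *)
Lemma runs_compositions d s :
  runs (compositions d s) ((5 * d + 1) * s.+1 ^ d)
    (fun ls : seq (seq nat) => (forall l : seq nat, l \in ls <-> size l = d /\ sumn l = s) /\
               (size ls <= comp_bound d s)%N).
Proof.
elim: d s => [|d IH] s.
  apply: runs_step => //=; case: (eqVneq s 0%N) => [->|s0]; split=> // l.
    by rewrite inE; split=> [/eqP->|[/size0nil ->]].
  by split=> // [[/size0nil -> /= E]]; rewrite -E in s0.
(* One value [x] of the first entry: [5 * d + 1] pays for the recursive call, the other 2 for
   prepending [x] to each list it returns. *)
have Hbody x acc : (x <= s)%N ->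
    runs (rest <-- compositions d (s - x) ;;
          for_each rest (fun l acc' => step 1 ((x :: l) :: acc')) acc)
      ((5 * d + 3) * s.+1 ^ d + 1)
      (fun acc' : seq (seq nat) => (forall l : seq nat, l \in acc' <-> l \in acc \/
          exists r, [/\ size r = d, sumn r = (s - x)%N & l = x :: r]) /\
        (size acc' <= size acc + comp_bound d (s - x))%N).
  move=> xs; have le1 : ((s - x).+1 ^ d <= s.+1 ^ d)%N.
    by apply: leq_expnl; lia.
  have le2 := leq_trans (comp_bound_le d (s - x)%N) le1.
  apply: runs_bind (IH (s - x)%N) _ _.
    by apply: (@leq_trans ((5 * d + 1) * s.+1 ^ d)%N); [rewrite leq_mul2l le1 orbT | lia].
  move=> rest [restP size_rest].
  have H := @runs_for_each _ _ (fun (zs acc' : seq (seq nat)) => (forall l : seq nat, l \in acc' <->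
      l \in acc \/ exists2 r, r \in zs & l = x :: r) /\
      (size acc' <= size acc + size zs)%N) 1 rest
      (fun l acc' => step 1 ((x :: l) :: acc')) acc.
  apply: runs_weaken (H _ _ _ (leqnn _)) _ _; last first.
  - move=> acc' [accP size_acc']; split; last first.
      by apply: leq_trans size_acc' _; rewrite leq_add2l.
    move=> l; rewrite accP; split=> [[|[r /restP[]]]|[|[r []]]].
    + by left.
    + by right; exists r.
    + by left.
    + by right; exists r => //; apply/restP.
  - have := leq_mul (leqnn (5 * d + 1)) le1.
    by move: (_ ^ _)%N (_ ^ _)%N le1 size_rest le2 => X Y; lia.
  - move=> zs z zs' acc' _ [accP size_acc']; apply: runs_step => //.
    split=> [l|]; last by rewrite size_rcons /=; lia.
    rewrite inE; split=> [/orP[/eqP->|/accP [|[r rz ->]]]|[lacc|[r]]].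
    + by right; exists z; rewrite // mem_rcons mem_head.
    + by left.
    + by right; exists r; rewrite // mem_rcons inE rz orbT.
    + by apply/orP; right; apply/accP; left.
    + rewrite mem_rcons inE => /orP[/eqP-> ->|rz ->]; first by rewrite eqxx.
      by apply/orP; right; apply/accP; right; exists r.
  - by split; [move=> l; split; [left | case=> // [[]]] | rewrite addn0].
rewrite /=.
have H := @runs_for_each _ _ (fun (ys : seq nat) (acc : seq (seq nat)) => (forall l : seq nat, l \in acc <->
    exists (x : nat) (r : seq nat), [/\ x \in ys, size r = d, sumn r = (s - x)%N & l = x :: r]) /\
    (size acc <= \sum_(x <- ys) comp_bound d (s - x))%N)
    ((5 * d + 3) * s.+1 ^ d + 1) (iota 0 s.+1).
apply: runs_weaken (H _ _ _ _ _ (leqnn _)) _ _; last first.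
- move=> acc [accP size_acc]; split; last first.
    exact: leq_trans size_acc (sum_comp_bound _ _).
  move=> l; rewrite accP; split=> [[x [r [xs rd rs ->]]]|].
    by move: xs; rewrite mem_iota /= rd rs => xs; split=> //; lia.
  case: l => [[]//|x r] /= [[rd] E]; exists x, r; split=> //; last by lia.
  by rewrite -[_ :: _]/(iota 0 s.+1) mem_iota; lia.
- have : (0 < s.+1 ^ d)%N by rewrite expn_gt0.
  by rewrite size_iota expnS; nia.
- move=> ys x zs acc def [accP size_acc].
  have xs : (x <= s)%N.
    have : x \in iota 0 s.+1 by rewrite def mem_cat mem_head orbT.
    by rewrite mem_iota.
  apply: runs_weaken (Hbody x acc xs) _ _ => // acc' [acc'P size_acc'].
  split=> [l|]; last by rewrite big_rcons /=; lia.
  split=> [/acc'P [/accP[y [r [yys rd rs ->]]]|[r [rd rs ->]]]|[y [r []]]].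
  + by exists y, r; rewrite mem_rcons inE yys orbT.
  + by exists x, r; rewrite mem_rcons mem_head.
  + rewrite mem_rcons inE => /orP[/eqP->|yys] rd rs ->; apply/acc'P.
      by right; exists r.
    by left; apply/accP; exists y, r.
- by split=> // l; split=> // [[x [r []]]].
Qed.

(** The bounds use [m] in place of the level [s], so that they serve all levels of a table. *)
Lemma runs_count_vectors k m s : (0 < k)%N -> (s <= m)%N ->
  runs (count_vectors k s) (10 * (k * m.+1 ^ k))
    (fun cs : seq (countvec k) => (forall c : countvec k, c \in cs <-> csum c = s) /\
               (size cs <= m.+1 ^ k.-1)%N).
Proof.
move=> k0 sm.
have le1 : (s.+1 ^ k <= m.+1 ^ k)%N by apply: leq_expnl.
have le2 : (s.+1 ^ k.-1 <= m.+1 ^ k.-1)%N by apply: leq_expnl.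
have le3 : (m.+1 ^ k.-1 <= m.+1 ^ k)%N by apply: leq_pexp2l; rewrite ?leq_pred.
have M0 : (0 < m.+1 ^ k)%N by rewrite expn_gt0.
apply: runs_bind (runs_compositions k s) _ _; first by nia.
move=> ls [lsP]; have -> : comp_bound k s = (s.+1 ^ k.-1)%N by case: k k0 {le1 le2 le3 lsP M0}.
move=> size_ls.
have H := @runs_for_each _ _ (fun (ys : seq (seq nat)) (acc : seq (countvec k)) => (forall c : countvec k, c \in acc <->
    exists2 l, l \in ys & c = vec_of_seq k l) /\ size acc = size ys)
    k.+1 ls (fun l acc => step k.+1 (vec_of_seq k l :: acc)) [::].
apply: runs_weaken (H _ _ _ (leqnn _)) _ _; last first.
- move=> cs [csP size_cs]; split; last by lia.
  move=> c; rewrite csP; split=> [[l /lsP[lk ls_s] ->]|cs_s].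
    rewrite -ls_s sumnE (big_nth 0%N) big_mkord lk.
    by apply: eq_bigr => i _; rewrite ffunE.
  exists [seq c i | i <- enum 'I_k].
    apply/lsP; rewrite size_map size_enum_ord; split=> //.
    by rewrite sumnE big_map big_enum.
  by apply/ffunP => i; rewrite ffunE (nth_map i) ?size_enum_ord // nth_ord_enum.
- by move: (m.+1 ^ k)%N (s.+1 ^ k)%N le1 le3 M0 => X Y; nia.
- move=> ys l zs acc _ [accP size_acc]; apply: runs_step => //; split; last first.
    by rewrite size_rcons /= size_acc.
  move=> c; rewrite inE; split=> [/orP[/eqP->|/accP[l' ll ->]]|[l']].
  + by exists l; rewrite // mem_rcons mem_head.
  + by exists l'; rewrite // mem_rcons inE ll orbT.
  + rewrite mem_rcons inE => /orP[/eqP-> ->|ll ->]; first by rewrite eqxx.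
    by apply/orP; right; apply/accP; exists l'.
- by split=> // c; split=> // [[]].
Qed.

(** * Payoffs *)

Section Play.
Variables (R : realFieldType) (kA kB : nat) (G : game R kA kB).
Variables (fm : countvec kA -> mixed R kB) (m : nat).
Implicit Types (h x y z : seq 'I_kA) (a : 'I_kA).

Definition window h := drop (size h - m) h.

(** Payoff of [y] played after the history [h]. Carrying the history, instead of indexing rounds
    from the start, makes payoffs split over concatenation. *)
Fixpoint gain h y : R :=
  if y is a :: y' then ubar G a (fm (counts (window h))) + gain (rcons h a) y'
  else 0.

Lemma gain_cat h y z : gain h (y ++ z) = gain h y + gain (h ++ y) z.
Proof.
elim: y h => [|a y IH] h /=; first by rewrite add0r cats0.
by rewrite IH cat_rcons addrA.
Qed.

Lemma gain_rcons h y a :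
  gain h (rcons y a) = gain h y + ubar G a (fm (counts (window (h ++ y)))).
Proof. by rewrite -cats1 gain_cat /= addr0. Qed.

Lemma payoff_gain x : payoff G fm m x = gain [::] x.
Proof.
(* With [nth] and a default, the summands for [x] and [rcons x a] can be compared term by term. *)
have payoffE a s : payoff G fm m s = \sum_(0 <= t < size s)
    ubar G (nth a s t) (fm (counts (drop (t - m) (take t s)))).
  by rewrite big_mkord; apply: eq_bigr => t _; rewrite (tnth_nth a).
elim/last_ind: x => [|x a IH]; first by rewrite /payoff big_ord0.
rewrite gain_rcons -IH !(payoffE a) size_rcons big_nat_recr //=.
rewrite nth_rcons ltnn eqxx -cats1 take_size_cat //; congr (_ + _).
apply: eq_big_nat => t /andP[_ tx].
by rewrite nth_cat tx takel_cat // ltnW.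
Qed.

Lemma size_window h : (size (window h) <= m)%N.
Proof. by rewrite size_drop; lia. Qed.

Lemma window_id h : (size h <= m)%N -> window h = h.
Proof. by rewrite /window => hm; rewrite (_ : _ - _ = 0)%N ?drop0 //; lia. Qed.

Lemma window_cat h y : window (window h ++ y) = window (h ++ y).
Proof.
have -> : window h ++ y = drop (size h - m) (h ++ y).
  rewrite drop_cat; case: ltnP => // hh; rewrite /window drop_oversize //.
  by rewrite (_ : _ - _ - _ = 0)%N ?drop0 //; lia.
by rewrite /window drop_drop size_drop size_cat; congr drop; lia.
Qed.

Lemma window_catl h y : (m <= size y)%N -> window (h ++ y) = window y.
Proof.
move=> my; rewrite /window size_cat drop_cat ltnNge leq_subRL; last by lia.
by rewrite (_ : _ <= _)%N //=; [congr drop; lia | lia].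
Qed.

(** The rule sees only the last [m] actions, and truncating the history before extending it does not
    change later windows. *)
Lemma gain_window h y : gain (window h) y = gain h y.
Proof.
elim: y h => //= a y IH h; rewrite (window_id (size_window h)); congr (_ + _).
by rewrite -IH -[in RHS]IH -!cats1 window_cat.
Qed.

(** A block of length at least [m] hides all that precedes it. Hence the second half of [S_2m] earns
    the same whenever it is played. *)
Lemma gain_catl h z y : (m <= size z)%N -> gain (h ++ z) y = gain z y.
Proof. by move=> mz; rewrite -gain_window window_catl // gain_window. Qed.

Lemma gain_ge0 h y : (forall a b, 0 <= utilA G a b) -> 0 <= gain h y.
Proof.
move=> u0; elim: y h => //= a y IH h; apply: addr_ge0 => //.
by apply: sumr_ge0 => j _; rewrite mulr_ge0 ?mixed_ge0.
Qed.

(** Every copy after the first follows a full copy that hides the earlier history. [schedule_payoff]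
    relies on this to evaluate only two copies. *)
Lemma gain_nseq h b r : (m <= size b)%N ->
  gain h (flatten (nseq r.+1 b)) = gain h b + r%:R * gain b b.
Proof.
move=> mb; elim: r h => [|r IH] h; first by rewrite /= cats0 mul0r addr0.
rewrite -[flatten _]/(b ++ flatten (nseq r.+1 b)) gain_cat IH gain_catl //.
by rewrite -natr1 mulrDl mul1r [_ * _ + _]addrC.
Qed.

End Play.

(** * Numeric bounds *)

Lemma leq_pmull_eq a q b : (0 < q)%N -> b = (a * q)%N -> (a <= b)%N.
Proof. by move=> q0 ->; rewrite leq_pmulr. Qed.

(** The left side copies the loops of [fill_prefix], with [P] standing for [(m + 1) ^ (k - 1)]. The
    unit [W] dominates every monomial of one level, and [m + 1] times [W] stays within the
    target. *)
Lemma prefix_time_le K k B m P : (0 < k)%N -> (0 < B)%N -> (0 < P)%N ->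
  (m.+1 * P + (m * (10 * (k * (m.+1 * P)) +
     (P * ((K + 15) * (k ^ 2 * B) + k).+1 + 1)).+1 + 1) <=
   (K + 31) * (B * k ^ 3 * ((m.+1 * P) * (m.+1 * P))))%N.
Proof.
move=> k0 B0 P0; set W := (B * (k * k * k) * (m.+1 * P))%N.
have le a q : (0 < q)%N -> W = (a * q)%N -> (a <= W)%N by exact: leq_pmull_eq.
have l1 : (k * (m.+1 * P) <= W)%N.
  by apply: (le _ (B * k * k)%N); [rewrite !muln_gt0 k0 B0 | rewrite /W; ring].
have l2 : (P * (k * k * B) <= W)%N.
  by apply: (le _ (k * m.+1)%N); [rewrite !muln_gt0 k0 | rewrite /W; ring].
have l3 : (P * k <= W)%N.
  by apply: (le _ (B * k * k * m.+1)%N); [rewrite !muln_gt0 k0 B0 | rewrite /W; ring].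
have l4 : (P <= W)%N by apply: leq_trans l3; rewrite leq_pmulr.
have l5 : (m.+1 * P <= W)%N by apply: leq_trans l1; rewrite leq_pmull.
have l6 : (m.+1 * W <= B * k ^ 3 * ((m.+1 * P) * (m.+1 * P)))%N.
  by apply: (@leq_pmull_eq _ P) => //; rewrite /W; ring.
have l7 : ((10 * (k * (m.+1 * P)) +
     (P * ((K + 15) * (k ^ 2 * B) + k).+1 + 1)).+1 <= (K + 29) * W)%N.
  have := leq_mul (leqnn (K + 15)) l2.
  by rewrite (_ : P * ((K + 15) * (k ^ 2 * B) + k).+1 = (K + 15) * (P * (k * k * B)) + P * k + P)%N; [lia | ring].
apply: (@leq_trans ((K + 31) * (m.+1 * W))); last by rewrite leq_mul2l l6 orbT.
have := leq_mul (leqnn m) l7; have := leq_mul (leqnn K) (leqnn W); nia.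
Qed.

(** The same scheme for [fill_window], where a level has up to [P * P] cells. Here [m.+1 * W] equals
    the target without the constant: the sum over levels uses up the last factor [m + 1]. *)
Lemma window_time_le K k B m P : (0 < k)%N -> (0 < B)%N -> (0 < P)%N ->
  ((m.+1 * P) * (m.+1 * P) + (10 * (k * (m.+1 * P)) + ((P * (3 * k).+1 + 1) +
    (m * (10 * (k * (m.+1 * P)) + (10 * (k * (m.+1 * P)) +
      (P * (P * ((K + 22) * (k ^ 3 * B) + 2 * k).+1 + 1).+1 + 1))).+1 + 1))) <=
   (K + 66) * (B * k ^ 3 * ((m.+1 * P) * (m.+1 * P))))%N.
Proof.
move=> k0 B0 P0; set W := (B * (k * k * k) * (m.+1 * P * P))%N.
have le a q : (0 < q)%N -> W = (a * q)%N -> (a <= W)%N by exact: leq_pmull_eq.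
have l1 : (k * (m.+1 * P) <= W)%N.
  by apply: (le _ (B * k * k * P)%N); [rewrite !muln_gt0 k0 B0 | rewrite /W; ring].
have l2 : (P * P * (k * k * k * B) <= W)%N.
  by apply: (le _ m.+1) => //; rewrite /W; ring.
have l3 : (P * P * k <= W)%N.
  by apply: (le _ (B * k * k * m.+1)%N); [rewrite !muln_gt0 k0 B0 | rewrite /W; ring].
have l4 : (P * P <= W)%N by apply: leq_trans l3; rewrite leq_pmulr.
have l5 : (P <= W)%N by apply: leq_trans l4; rewrite leq_pmulr.
have l6 : (P * k <= W)%N by apply: leq_trans l3; rewrite -mulnA leq_pmull.
have l7 : (m.+1 * W = B * k ^ 3 * ((m.+1 * P) * (m.+1 * P)))%N by rewrite /W; ring.
have l8 : ((10 * (k * (m.+1 * P)) + (10 * (k * (m.+1 * P)) +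
      (P * (P * ((K + 22) * (k ^ 3 * B) + 2 * k).+1 + 1).+1 + 1))).+1 <=
      (K + 49) * W)%N.
  have := leq_mul (leqnn (K + 22)) l2.
  rewrite (_ : P * (P * ((K + 22) * (k ^ 3 * B) + 2 * k).+1 + 1).+1 =
    (K + 22) * (P * P * (k * k * k * B)) + 2 * (P * P * k) + P * P + 2 * P)%N; last ring.
  lia.
have l9 : ((m.+1 * P) * (m.+1 * P) <= m.+1 * W)%N.
  by rewrite l7; apply: leq_pmull; rewrite muln_gt0 B0 expn_gt0 k0.
rewrite -l7 [(P * (3 * k).+1)%N](_ : _ = 3 * (P * k) + P)%N; last ring.
have := leq_mul (leqnn m) l8.
rewrite (_ : m * ((K + 49) * W) = (K + 49) * (m * W))%N; last ring.
rewrite (_ : (K + 66) * (m.+1 * W) = (K + 66) * W + (K + 66) * (m * W))%N; last ring.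
(* Once the products are replaced by atoms, what remains is linear. *)
move: l9 l6 l5 l1 P0; rewrite [(m.+1 * W)%N]mulSn; clear.
move: (m * _.+1)%N => t1; move: (m.+1 * P * (m.+1 * P))%N => t2.
move: (k * (m.+1 * P))%N => t3; move: (P * k)%N => t4; move: (m * W)%N => t5.
move: W => W; rewrite !mulnDl; move: (K * W)%N (K * t5)%N => t6 t7; lia.
Qed.

(** The monomials of the remaining phases: enumerating vectors, scanning either table for its best
    entry, and evaluating schedules. *)
Lemma loop_time_le m k B : (0 < k)%N -> (0 < B)%N ->
  let Z := (B * k ^ 3 * m.+1 ^ (2 * k))%N in
  [/\ k * m.+1 ^ k <= Z, m.+1 ^ k.-1 * m.+1 ^ k.-1 * k <= Z,
      m.+1 ^ k.-1 * k <= Z & m.+1 * m.+1 * (k * B) <= Z]%N.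
Proof.
move=> k0 B0 Z; set P := (m.+1 ^ k.-1)%N.
have P0 : (0 < P)%N by rewrite expn_gt0.
have -> : (m.+1 ^ k = m.+1 * P)%N by rewrite -expnS prednK.
have -> : Z = (B * k ^ 3 * ((m.+1 * P) * (m.+1 * P)))%N.
  by rewrite /Z -expnS prednK // -expnD addnn -mul2n.
split.
- apply: (@leq_pmull_eq _ (B * k * k * (m.+1 * P))); last ring.
  by rewrite !muln_gt0 B0 k0.
- apply: (@leq_pmull_eq _ (B * k * k * (m.+1 * m.+1))); last ring.
  by rewrite !muln_gt0 B0 k0.
- apply: (@leq_pmull_eq _ (B * k * k * (m.+1 * m.+1 * P))); last ring.
  by rewrite !muln_gt0 B0 k0.
- apply: (@leq_pmull_eq _ (k * k * (P * P))); last ring.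
  by rewrite !muln_gt0 P0 k0.
Qed.

Lemma iota_prefix a n ys s zs : iota a n = ys ++ s :: zs ->
  s = (a + size ys)%N /\ (size ys < n)%N.
Proof.
move=> def; have sz : (size ys < n)%N.
  by rewrite -(size_iota a n) def size_cat /=; lia.
by split=> //; rewrite -(nth_iota 0 a sz) def nth_cat ltnn subnn.
Qed.

(** * The dynamic programs *)

Section DynamicPrograms.
Variables (R : realFieldType) (kA kB : nat) (G : game R kA kB).
Variables (f : countvec kA -> timed (mixed R kB)) (m K : nat).
Hypotheses (kA_gt0 : (0 < kA)%N) (kB_gt0 : (0 < kB)%N) (m_gt0 : (0 < m)%N).
Hypothesis f_time : forall c, (csum c <= m)%N -> (time (f c) <= K * (kA * kB))%N.
Implicit Types (c : countvec kA) (i j : 'I_kA) (x y z : seq 'I_kA) (v : R).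

Local Notation fm := (fun c => result (f c)).
Local Notation u i c := (ubar G i (result (f c))).
Local Notation g := (gain G fm m).

Let Z := (kB * kA ^ 3 * m.+1 ^ (2 * kA))%N.

Lemma runs_round_payoff i c : (csum c <= m)%N ->
  runs (round_payoff G f i c) ((K + 6) * (kA * kB)) (eq (u i c)).
Proof.
move=> cm; apply: (runs_bind (j := (K * (kA * kB))%N) (P := eq (result (f c)))).
- by split; first exact: f_time.
- by nia.
move=> _ <-; apply: runs_weaken (runs_for_each (b := 4)
  (P := fun ys acc => acc = \sum_(j <- ys) result (f c) j * utilA G i j) _ _ (leqnn _)) _ _.
- by rewrite big_nil.
- by move=> ys j zs acc _ ->; apply: runs_step => //; rewrite big_rcons.
- by rewrite size_enum_ord; nia.
- by move=> _ ->; rewrite /ubar big_enum.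
Qed.

(** ** The first block *)

Definition prefix_opt c v :=
  (forall x, counts x = c -> g [::] x <= v) /\
  (exists2 x, counts x = c & g [::] x = v).

(** [v] is the best payoff among orderings of [c] that end with [i]. *)
Definition prefix_cand c i v :=
  (0 < c i)%N /\ prefix_opt (decr c i) (v - u i (decr c i)).

Definition prefix_entry c (e : option (R * 'I_kA)) :=
  exists v i, [/\ e = Some (v, i), prefix_opt c v & prefix_cand c i v].

Lemma prefix_opt_uniq c v v' : prefix_opt c v -> prefix_opt c v' -> v = v'.
Proof.
move=> [le_v [x xc gx]] [le_v' [x' xc' gx']]; apply/le_anti/andP.
by split; [rewrite -gx le_v' | rewrite -gx' le_v].
Qed.

Lemma counts_eq0 x c : counts x = c -> csum c = 0%N -> x = [::].
Proof. by move=> <-; rewrite csum_counts => /size0nil. Qed.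

Lemma prefix_opt0 c : csum c = 0%N -> prefix_opt c 0.
Proof.
move=> c0; split=> [x /counts_eq0 -> //|]; exists [::] => //.
by rewrite counts_nil (csum_eq0 c0).
Qed.

Lemma gain_prefix_rcons x i : (size x <= m)%N ->
  g [::] (rcons x i) = g [::] x + u i (counts x).
Proof. by move=> xm; rewrite gain_rcons window_id. Qed.

(** Bellman's principle: removing the last action [j] of an ordering of [c] leaves an ordering of
    [decr c j], and these counts determine the payoff of [j], since all earlier actions are still
    visible. *)
Lemma prefix_opt_step c i v : (csum c <= m)%N -> prefix_cand c i v ->
  (forall j, (0 < c j)%N -> exists2 v', prefix_cand c j v' & v' <= v) ->
  prefix_opt c v.
Proof.
move=> cm [ci [le_v [x xc gx]]] max; split.
  elim/last_ind=> [|y j _] yc.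
    by move: (ci); rewrite -yc counts_nil ffunE.
  have cj : (0 < c j)%N by rewrite -yc counts_rcons incr_gt0.
  have yc' : counts y = decr c j by rewrite -yc counts_rcons incrK.
  have ym : (size y <= m)%N by rewrite -csum_counts yc'; have := csum_decr cj; lia.
  rewrite gain_prefix_rcons // yc'.
  have [v' [_ [le_v' _]] /(le_trans _)] := max j cj; apply.
  by rewrite -lerBrDr le_v'.
have xm : (size x <= m)%N by rewrite -csum_counts xc; have := csum_decr ci; lia.
exists (rcons x i); first by rewrite counts_rcons xc decrK.
by rewrite gain_prefix_rcons // gx xc subrK.
Qed.

Lemma runs_prefix_cell (V : prefix_table R kA) s c :
  csum c = s -> (0 < s <= m)%N ->
  (forall c', (0 < csum c' < s)%N -> prefix_entry c' (V c')) ->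
  runs (prefix_cell G f V s c) ((K + 15) * (kA ^ 2 * kB)) (prefix_entry c).
Proof.
move=> cs /andP[s0 sm] HV.
(* Tables are filled from level 1 on; at that level the value 0 of the empty sequence replaces the
   read. *)
have oldP i : (0 < c i)%N -> exists2 v, prefix_opt (decr c i) v &
    (if s == 1%N then Some 0 else omap fst (V (decr c i))) = Some v.
  move=> ci; have := csum_decr ci; rewrite cs; case: eqP => [->|s1] [E].
    by exists 0 => //; apply: prefix_opt0; lia.
  have [|v [j [-> v_opt _]]] := HV (decr c i); first by lia.
  by exists v.
pose A i d v := d = i /\ prefix_cand c i v.
apply: runs_weaken (runs_maximize (contributes_for_each
  (2 * kA + (K + 6) * (kA * kB) + 5)%N A _ (leqnn _))) _ _.
- move=> i _ best Q HQ; apply: runs_bind_step; first by lia.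
  case: ifPn => [ci|ci]; last first.
    by apply: contributes_none HQ => d v [_ []]; rewrite (negbTE ci).
  have [v v_opt old] := oldP i ci.
  apply: runs_bind_step; first by lia.
  apply: runs_bind_step; first by lia.
  apply: (runs_bind (j := kA.+1) (P := eq (Some v))); [|by lia|move=> _ <-].
    move: old; case: ifP => _ old; first by apply: runs_step.
    by apply: runs_bind_step => //; apply: runs_step; [lia | rewrite old].
  apply: runs_bind (runs_round_payoff _ _) _ _; [|by lia|move=> _ <-].
    by have := csum_decr ci; lia.
  apply: runs_bind_step; first by lia.
  apply: contributes_keep_best HQ; first by lia.
  move=> d w; split=> [[-> [_ /(prefix_opt_uniq v_opt) ->]]|[-> ->]].
    by rewrite subrK.
  by split=> //; split=> //; rewrite addrK.
- rewrite size_enum_ord; have := leq_pmulr (kA ^ 2)%N kB_gt0.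
  by rewrite -mulnn; nia.
have Acand i v : (exists2 j, j \in enum 'I_kA & A j i v) <-> prefix_cand c i v.
  split=> [[j _ [-> //]]|ci]; exists i => //; exact: mem_enum.
have exA i : (0 < c i)%N -> exists v, prefix_cand c i v.
  move=> ci; have [v v_opt _] := oldP i ci.
  by exists (v + u i (decr c i)); split=> //; rewrite addrK.
case=> [[v i]|] /=; last first.
  move=> none; have [i ci] : exists i, (0 < c i)%N.
    apply/existsP; apply: contraLR s0 => /existsPn c0; rewrite -cs -leqNgt leqn0.
    by rewrite sum_nat_eq0; apply/forallP => i; rewrite -leqn0 leqNgt c0.
  by have [v /Acand /none] := exA i ci.
move=> [/Acand ci max]; exists v, i; split=> //.
apply: prefix_opt_step (ci) _; first by rewrite cs.
by move=> j /exA [v' cj]; exists v' => //; apply: (max j); apply/Acand.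
Qed.

Lemma runs_fill_prefix : runs (fill_prefix G f m) ((K + 31) * Z)
  (fun V => forall c, (0 < csum c <= m)%N -> prefix_entry c (V c)).
Proof.
set P := (m.+1 ^ kA.-1)%N; have P0 : (0 < P)%N by rewrite expn_gt0.
have defP : (m.+1 ^ kA = m.+1 * P)%N by rewrite -expnS prednK.
have := prefix_time_le K m kA_gt0 kB_gt0 P0.
rewrite -defP -expnD addnn -muln2 [(kA * 2)%N]mulnC -/Z => time_le.
apply: runs_bind_step; first by apply: leq_trans time_le; apply: leq_addr.
apply: runs_weaken (runs_for_each
  (b := (10 * (kA * m.+1 ^ kA) + (P * ((K + 15) * (kA ^ 2 * kB) + kA).+1 + 1))%N)
  (P := fun ss (V : prefix_table R kA) =>
    forall c, (0 < csum c <= size ss)%N -> prefix_entry c (V c))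
  _ _ (leqnn _)) _ _; last first.
- by move=> V; rewrite size_iota.
- by rewrite size_iota leq_subRL //; apply: leq_trans time_le; apply: leq_addr.
- move=> ss s zs V /iota_prefix [-> ss_m] HV; set s1 := (1 + size ss)%N.
  apply: runs_bind (runs_count_vectors kA_gt0 (_ : s1 <= m)%N) _ _ => //.
    exact: leq_addr.
  move=> cs [csP size_cs].
  (* Within a level, correct cells are those of lower levels and of the vectors [ds] visited so far;
     a cell reads lower levels only. *)
  apply: runs_weaken (runs_for_each (b := ((K + 15) * (kA ^ 2 * kB) + kA)%N)
    (P := fun ds (V' : prefix_table R kA) => forall c,
      (0 < csum c <= size ss)%N \/ c \in ds -> prefix_entry c (V' c))
    _ _ (leqnn _)) _ _.
  + by move=> c [/HV|].
  + move=> ds c ds' V' def HV'.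
    have cs1 : csum c = s1 by apply/csP; rewrite def mem_cat mem_head orbT.
    apply: runs_bind (runs_prefix_cell cs1 _ _) _ _.
    * by rewrite /s1; lia.
    * by move=> c' c's; apply: HV'; left; rewrite /s1 in c's; lia.
    * exact: leq_addr.
    move=> e eP; apply: runs_step; first by rewrite addKn.
    move=> c'; case: eqP => [-> //|c'c].
    rewrite mem_rcons inE => -[c's|/orP[/eqP//|c'ds]]; apply: HV'; first by left.
    by right.
  + by rewrite addKn leq_add2r leq_mul2r size_cs orbT.
  + move=> V' HV' c; rewrite size_rcons => c_le; apply: HV'.
    case: (ltnP (size ss) (csum c)) => c_ss; last by left; lia.
    by right; apply/csP; rewrite /s1; lia.
- by move=> c /=; lia.
Qed.

(** Removing the recorded last action leads to a cell whose optimum is the current one minus the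
    last round, so the recovered ordering attains [v]. *)
Lemma runs_backtrack_prefix (V : prefix_table R kA) n c acc v :
  (forall c, (0 < csum c <= m)%N -> prefix_entry c (V c)) ->
  csum c = n -> (n <= m)%N -> prefix_opt c v ->
  runs (backtrack_prefix V n c acc) (n * (2 * kA + 1) + 1)
    (fun x => exists y, [/\ x = y ++ acc, counts y = c & g [::] y = v]).
Proof.
move=> HV; elim: n c acc v => [|n IH] c acc v cn nm v_opt.
  apply: runs_step => //; exists [::]; rewrite counts_nil (csum_eq0 cn).
  by split=> //; apply: prefix_opt_uniq v_opt; apply: prefix_opt0.
have [|w [i [eVc w_opt [ci w'_opt]]]] := HV c; first by rewrite cn.
apply: runs_bind_step; first by lia.
rewrite {}eVc; apply: runs_bind_step; first by lia.
apply: runs_bind_step; first by lia.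
have c1n : csum (decr c i) = n by have := csum_decr ci; lia.
apply: runs_weaken (IH _ (i :: acc) _ c1n (ltnW nm) w'_opt) _ _; first by lia.
move=> x [y [-> yc gy]]; exists (rcons y i); rewrite cat_rcons counts_rcons yc decrK //.
split=> //; rewrite gain_prefix_rcons; last by rewrite -csum_counts yc c1n ltnW.
by rewrite gy yc subrK (prefix_opt_uniq v_opt w_opt).
Qed.

Lemma ex_counts n : exists c, csum c = n.
Proof.
by exists (counts (nseq n (Ordinal kA_gt0))); rewrite csum_counts size_nseq.
Qed.

Lemma runs_compute_Sm : runs (compute_Sm G f m) ((K + 50) * Z)
  (fun S => size S = m /\ forall x, size x = m -> g [::] x <= g [::] S).
Proof.
have [l1 _ l2 l3] := loop_time_le m kA_gt0 kB_gt0; rewrite -/Z in l1 l2 l3.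
have P0 : (0 < m.+1 ^ kA.-1)%N by rewrite expn_gt0.
have l4 : (m.+1 ^ kA.-1 <= Z)%N by apply: leq_trans l2; rewrite leq_pmulr.
have l5 : (m * kA <= Z)%N by apply: leq_trans l3; nia.
apply: runs_bind runs_fill_prefix _ _; first by rewrite leq_mul2r; lia.
move=> V HV.
apply: runs_bind (runs_count_vectors kA_gt0 (leqnn m)) _ _; first by lia.
move=> cs [csP size_cs].
have HVm c : c \in cs -> prefix_entry c (V c).
  by move/csP => cm; apply: HV; rewrite cm m_gt0 leqnn.
apply: (runs_bind (j := (m.+1 ^ kA.-1 * kA.+2 + 1)%N)).
- apply: runs_maximize; apply: (contributes_for_each kA.+1
    (fun c d v => d = c /\ prefix_opt c v)); last first.
    by rewrite leq_add2r leq_mul2r size_cs orbT.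
  move=> c /HVm [v [i [eV v_opt _]]] best Q HQ; apply: runs_bind_step => //.
  rewrite eV; apply: contributes_keep_best HQ; first by rewrite subSnn.
  move=> d w; split=> [[-> /(prefix_opt_uniq v_opt) ->]|[-> ->]] //.
- by nia.
case=> [[v c]|] /= best; last first.
  (* As [kA > 0], vectors of sum [m] exist, so the search cannot come back empty. *)
  have [c cm] := ex_counts m; have /csP c_cs := cm.
  have [v [i [_ v_opt _]]] := HVm c c_cs.
  by case: (best c v); exists c.
have [[d d_cs [def_d v_opt]] max] := best; rewrite {}def_d in best d_cs max *.
apply: runs_weaken (runs_backtrack_prefix [::] HV _ (leqnn m) v_opt) _ _.
- exact/csP.
- by nia.
move=> x [y [-> yc gy]]; rewrite cats0; split.
  by rewrite -csum_counts yc; apply/csP.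
move=> z zm; have z_cs : counts z \in cs by apply/csP; rewrite csum_counts.
have [w [i [_ w_opt _]]] := HVm _ z_cs.
rewrite gy; apply: le_trans (max (counts z) w _); last by exists (counts z).
by case: w_opt => le_w _; apply: le_w.
Qed.

(** ** The last rounds of a window *)

(* [v] is the best payoff in rounds [m + 1, ..., m + s] when [c] counts the
   actions in rounds [s + 1, ..., m] and [c'] those in rounds
   [m + 1, ..., m + s]; the order of the former does not matter. *)
Definition window_opt c c' v :=
  (forall x z y, size x = size y -> counts z = c -> counts y = c' ->
     g (x ++ z) y <= v) /\
  (exists x y, [/\ size x = size y, counts y = c' &
     forall z, counts z = c -> g (x ++ z) y = v]).

(** With [s] the sum of [c'], [j] is the action of round [m + s] and [i] that of round [s], the
    oldest one visible at that time. The subtracted term is the payoff of round [m + s]. *)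
Definition window_cand c c' i j v :=
  (0 < c' j)%N /\
  window_opt (incr c i) (decr c' j)
    (v - u j (decr (incr (Defs.addv c c') i) j)).

Definition window_entry c c' (e : option (R * option ('I_kA * 'I_kA))) :=
  exists v d, [/\ e = Some (v, d), window_opt c c' v &
    if d is Some (i, j) then window_cand c c' i j v else csum c' = 0%N].

(** An optimal pair for one value competes for the other; [countsP] supplies a listing of [c] on
    which to evaluate both. *)
Lemma window_opt_uniq c c' v v' :
  window_opt c c' v -> window_opt c c' v' -> v = v'.
Proof.
move=> [le_v [x [y [xy yc' gx]]]] [le_v' [x' [y' [xy' yc'' gx']]]].
have [z zc] := countsP c; apply/le_anti/andP; split.
  by rewrite -(gx z zc); apply: le_v'.
by rewrite -(gx' z zc); apply: le_v.
Qed.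

Lemma window_opt0 c : window_opt c (zerov kA) 0.
Proof.
have csum0 : csum (zerov kA) = 0%N by rewrite -counts_nil csum_counts.
split=> [x z y _ _ y0|]; first by rewrite (counts_eq0 y0 csum0).
by exists [::], [::]; rewrite counts_nil.
Qed.

(** Before the last round exactly [i], [z] and [y] are visible, [m] actions in all, while [x] has
    dropped out of sight. *)
Lemma gain_window_rcons x z y i j :
  size x = size y -> (size z + size y).+1 = m ->
  g (rcons x i ++ z) (rcons y j) = g (x ++ i :: z) y +
    u j (decr (incr (Defs.addv (counts z) (counts (rcons y j))) i) j).
Proof.
move=> xy zy; rewrite gain_rcons cat_rcons; congr (_ + ubar G j (result (f _))).
rewrite /window -catA size_cat drop_size_cat; last by rewrite size_cat /=; lia.
rewrite counts_cat counts_cons counts_rcons.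
by apply/ffunP => l; rewrite !ffunE; lia.
Qed.

(** An optimal pair for [incr c i] and [decr c' j] works for every listing of [incr c i], in
    particular for [i :: z], and so it can be extended by [i] and [j]. Conversely, a competitor
    stripped of its last actions [i'] and [j'] is bounded by the candidate for that pair. *)
Lemma window_opt_step c c' i j v :
  (csum c + csum c')%N = m -> window_cand c c' i j v ->
  (forall i' j', (0 < c' j')%N ->
     exists2 v', window_cand c c' i' j' v' & v' <= v) ->
  window_opt c c' v.
Proof.
move=> cc' [c'j [_ [x [y [xy yc' gxy]]]]] max; split; last first.
  exists (rcons x i), (rcons y j).
  have yc'j : counts (rcons y j) = c' by rewrite counts_rcons yc' decrK.
  split=> // [|z zc]; first by rewrite !size_rcons xy.
  rewrite gain_window_rcons // ?yc'j ?zc ?gxy ?subrK //.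
    by rewrite counts_cons zc.
  by rewrite -!csum_counts zc yc' -addnS csum_decr.
move=> x' z; elim/last_ind=> [|y' j' _].
  by move=> _ _ c'0; move: c'j; rewrite -c'0 counts_nil ffunE.
case/lastP: x' => [|x' i']; first by rewrite size_rcons.
rewrite !size_rcons => -[xy'] zc yc''.
have c'j' : (0 < c' j')%N by rewrite -yc'' counts_rcons incr_gt0.
have yc1 : counts y' = decr c' j' by rewrite -yc'' counts_rcons incrK.
have [v' [_ [le_v' _]] /(le_trans _)] := max i' j' c'j'; apply.
rewrite gain_window_rcons //; last by rewrite -!csum_counts zc yc1 -addnS csum_decr.
by rewrite zc yc'' -lerBrDr le_v' // counts_cons zc.
Qed.

Lemma runs_window_cell (V : window_table R kA) c c' :
  (csum c + csum c')%N = m -> (0 < csum c')%N ->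
  (forall d d', (csum d + csum d')%N = m -> (csum d' < csum c')%N ->
     window_entry d d' (V (d, d'))) ->
  runs (window_cell G f V c c') ((K + 22) * (kA ^ 3 * kB)) (window_entry c c').
Proof.
move=> cc' c'0 HV.
have oldP i j : (0 < c' j)%N -> exists v d,
    window_opt (incr c i) (decr c' j) v /\ V (incr c i, decr c' j) = Some (v, d).
  move=> c'j; have := csum_decr c'j => E.
  have [||v [d [-> v_opt _]]] := HV (incr c i) (decr c' j).
  - by rewrite csum_incr; lia.
  - by lia.
  - by exists v, d.
pose A i j (d : option ('I_kA * 'I_kA)) v := d = Some (i, j) /\ window_cand c c' i j v.
have k3 : (kA * (kA * (7 * kA + (K + 6) * (kA * kB) + 5).+1 + 1).+1 + 1 <=
    (K + 22) * (kA ^ 3 * kB))%N.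
  have l1 := leq_pmulr (kA ^ 3)%N kB_gt0.
  have l2 : (kA <= kA * kA)%N by rewrite leq_pmulr.
  have l3 : (kA * kA <= kA ^ 3)%N by rewrite !expnS expn0 muln1 mulnA leq_pmulr.
  rewrite (_ : _ + 1 = 7 * (kA ^ 3) + (K + 6) * (kA ^ 3 * kB) + 6 * (kA * kA) + 2 * kA + 1)%N; last ring.
  have l4 : (0 < kA ^ 3 * kB)%N by rewrite muln_gt0 expn_gt0 kA_gt0.
  by rewrite !mulnDl; move: (K * _)%N => t; lia.
apply: runs_weaken (runs_maximize (contributes_for_each
  (kA * (7 * kA + (K + 6) * (kA * kB) + 5).+1 + 1)%N
  (fun i d v => exists2 j, j \in enum 'I_kA & A i j d v) _ (leqnn _))) _ _.
- move=> i _; apply: (contributes_for_each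
    (7 * kA + (K + 6) * (kA * kB) + 5)%N (A i)); last by rewrite size_enum_ord.
  move=> j _ best Q HQ; apply: runs_bind_step; first by lia.
  case: ifPn => [c'j|c'j]; last first.
    by apply: contributes_none HQ => d v [_ []]; rewrite (negbTE c'j).
  have [v [d [v_opt old]]] := oldP i j c'j.
  apply: runs_bind_step; first by lia.
  apply: runs_bind_step; first by lia.
  apply: runs_bind_step; first by lia.
  rewrite old; apply: runs_bind_step; first by lia.
  apply: runs_bind (runs_round_payoff _ _) _ _; [|by lia|move=> _ <-].
    (* The visible vector has sum [m], within the range of the cost assumption on [f]. *)
    have : csum (incr (Defs.addv c c') i) = m.+1 by rewrite csum_incr csum_addv cc'.
    have E : (0 < incr (Defs.addv c c') i j)%N by rewrite !ffunE; lia.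
    by have := csum_decr E; lia.
  apply: runs_bind_step; first by lia.
  apply: contributes_keep_best HQ; first by lia.
  move=> d' w; split=> [[-> [_ /(window_opt_uniq v_opt) ->]]|[-> ->]].
    by rewrite subrK.
  by split=> //; split=> //; rewrite addrK.
- by rewrite size_enum_ord.
have Acand i j v : window_cand c c' i j v ->
    exists2 i', i' \in enum 'I_kA & exists2 j', j' \in enum 'I_kA & A i' j' (Some (i, j)) v.
  by move=> ?; exists i; rewrite ?mem_enum //; exists j; rewrite ?mem_enum.
have exA i j : (0 < c' j)%N -> exists v, window_cand c c' i j v.
  move=> c'j; have [v [d [v_opt _]]] := oldP i j c'j.
  by exists (v + u j (decr (incr (Defs.addv c c') i) j)); split=> //; rewrite addrK.
case=> [[v d]|] /=; last first.
  move=> none; have [j c'j] : exists j, (0 < c' j)%N.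
    apply/existsP; apply: contraLR c'0 => /existsPn c'0; rewrite -leqNgt leqn0.
    by rewrite sum_nat_eq0; apply/forallP => j; rewrite -leqn0 leqNgt c'0.
  by have [v /Acand /none] := exA j j c'j.
move=> [[i _ [j _ [-> ci]]] max]; exists v, (Some (i, j)); split=> //.
apply: window_opt_step (ci) _ => // i' j' /(exA i') [v' cj].
by exists v' => //; apply: max (Acand _ _ _ cj).
Qed.

Lemma runs_fill_window : runs (fill_window G f m) ((K + 66) * Z)
  (fun V => forall c c', (csum c + csum c')%N = m -> window_entry c c' (V (c, c'))).
Proof.
set P := (m.+1 ^ kA.-1)%N; have P0 : (0 < P)%N by rewrite expn_gt0.
have defP : (m.+1 ^ kA = m.+1 * P)%N by rewrite -expnS prednK.
have := window_time_le K m kA_gt0 kB_gt0 P0.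
rewrite -defP -expnD addnn -mul2n -/Z.
(* Costs of one enumeration, the initialization, a cell, a row and a level, nested as in
   [window_time_le]. *)
set tc := (10 * (kA * m.+1 ^ kA))%N; set tz := (P * (3 * kA).+1 + 1)%N.
set cell := ((K + 22) * (kA ^ 3 * kB) + 2 * kA)%N.
set row := (P * cell.+1 + 1)%N; set level := (tc + (tc + (P * row.+1 + 1)))%N.
move=> time_le.
apply: runs_bind_step; first by lia.
apply: runs_bind (runs_count_vectors kA_gt0 (leqnn m)) _ _; first by rewrite -/tc; lia.
move=> full [fullP size_full].
apply: (runs_bind (j := tz) (P := fun V : window_table R kA =>
  forall c c', (csum c + csum c')%N = m -> csum c' = 0%N ->
    window_entry c c' (V (c, c')))).
- apply: runs_weaken (runs_for_each (b := (3 * kA)%N)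
    (P := fun cs (V : window_table R kA) => forall c, c \in cs ->
      window_entry c (zerov kA) (V (c, zerov kA))) _ _ (leqnn _)) _ _ => //.
  + move=> cs c cs' V _ HV; apply: runs_bind_step; first by lia.
    apply: runs_step; first by lia.
    move=> c'; case: eqP => [[->] _|ne].
      exists 0, None; split=> //; first exact: window_opt0.
      by rewrite -counts_nil csum_counts.
    by rewrite mem_rcons inE => /orP[/eqP c'c|/HV//]; rewrite c'c in ne.
  + by rewrite leq_add2r leq_mul2r size_full orbT.
  + move=> V HV c c' cc' c'0; rewrite (csum_eq0 c'0); apply: HV; apply/fullP.
    by rewrite -cc' c'0 addn0.
- by rewrite -/tc; lia.
move=> V1 HV1; apply: runs_weaken (runs_for_each (b := level)
  (P := fun ss (V : window_table R kA) => forall c c',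
    (csum c + csum c')%N = m -> (csum c' <= size ss)%N ->
    window_entry c c' (V (c, c'))) _ _ (leqnn _)) _ _; last first.
- by move=> V; rewrite size_iota => HV c c' cc'; apply: HV => //; lia.
- by rewrite size_iota -/tc; lia.
- move=> ss s zs V /iota_prefix [-> ss_m] HV; set s1 := (1 + size ss)%N.
  apply: runs_bind (runs_count_vectors kA_gt0 (leq_subr s1 m)) _ _.
    by rewrite -/tc /level; lia.
  move=> cs [csP size_cs].
  apply: runs_bind (runs_count_vectors kA_gt0 (_ : s1 <= m)%N) _ _; first by rewrite /s1; lia.
    by rewrite -/tc /level; lia.
  move=> cs' [csP' size_cs'].
  (* Besides the lower levels, the rows [ds] of level [s1] are complete; the inner invariant adds
     the visited part of the current row. *)
  apply: runs_weaken (runs_for_each (b := row)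
    (P := fun ds (V' : window_table R kA) => forall c c',
      (csum c + csum c')%N = m ->
      (csum c' <= size ss)%N \/ csum c' = s1 /\ c \in ds ->
      window_entry c c' (V' (c, c'))) _ _ (leqnn _)) _ _.
  + by move=> c c' cc' [|[]//]; apply: HV.
  + move=> ds c ds' V' def HV'.
    have c_s1 : csum c = (m - s1)%N by apply/csP; rewrite def mem_cat mem_head orbT.
    apply: runs_weaken (runs_for_each (b := cell)
      (P := fun es (W : window_table R kA) => forall d d',
        (csum d + csum d')%N = m ->
        (csum d' <= size ss)%N \/ csum d' = s1 /\ (d \in ds \/ d = c /\ d' \in es) ->
        window_entry d d' (W (d, d'))) _ _ (leqnn _)) _ _.
    * by move=> d d' dd' [d'_le|[d's1 [d_ds|[]//]]]; apply: HV' => //; [left | right].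
    * move=> es c' es' W def' HW.
      have c'_s1 : csum c' = s1 by apply/csP'; rewrite def' mem_cat mem_head orbT.
      apply: runs_bind (runs_window_cell _ _ _) _ _.
      - by rewrite c_s1 c'_s1 /s1; lia.
      - by rewrite c'_s1.
      - by move=> d d' dd' d'c'; apply: HW => //; left; rewrite c'_s1 /s1 in d'c'; lia.
      - exact: leq_addr.
      move=> e eP; apply: runs_step; first by rewrite addKn.
      move=> d d' dd'; case: eqP => [[-> ->] //|ne].
      rewrite mem_rcons inE => H; apply: HW => //.
      case: H => [|[d's1 [d_ds|[dc /orP[/eqP d'c'|d'_es]]]]]; first by left.
      + by right; split=> //; left.
      + by rewrite dc d'c' in ne.
      + by right; split=> //; right.
    * by rewrite leq_add2r leq_mul2r size_cs' orbT.
    * move=> W HW d d' dd' H; apply: HW => //.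
      case: H => [|[d's1]]; first by left.
      rewrite mem_rcons inE => /orP[/eqP dc|d_ds]; right; split=> //; last by left.
      by right; split=> //; apply/csP'.
  + rewrite -/tc /level addKn addKn.
    by rewrite leq_add2r leq_mul2r size_cs orbT.
  + move=> V' HV' c c' cc'; rewrite size_rcons => c'_le; apply: HV' => //.
    case: (ltnP (size ss) (csum c')) => c'_ss; [right | by left].
    have c's1 : csum c' = s1 by rewrite /s1; lia.
    by split=> //; apply/csP; lia.
- by move=> c c' cc' /=; rewrite leqn0 => /eqP; apply: HV1.
Qed.

(** The listing [z] stays universally quantified because [recover_window] chooses the middle actions
    separately. *)
Lemma runs_backtrack_window (V : window_table R kA) n c c' pre post v :
  (forall c c', (csum c + csum c')%N = m -> window_entry c c' (V (c, c'))) ->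
  (csum c + csum c')%N = m -> csum c' = n -> window_opt c c' v ->
  runs (backtrack_window V n c c' pre post) (n * (4 * kA + 2) + 1)
    (fun r => exists x y, [/\ r = (x ++ pre, y ++ post), size x = size y,
       counts y = c' & forall z, counts z = c -> g (x ++ z) y = v]).
Proof.
move=> HV; elim: n c c' pre post v => [|n IH] c c' pre post v cc' c'n v_opt.
  apply: runs_step => //; exists [::], [::].
  rewrite counts_nil (csum_eq0 c'n); split=> // z _.
  apply: window_opt_uniq v_opt; rewrite (csum_eq0 c'n); exact: window_opt0.
have [w [d [eV w_opt dP]]] := HV c c' cc'.
apply: runs_bind_step; first by lia.
rewrite {}eV; case: d dP => [[i j] [c'j w'_opt]|]; last by rewrite c'n.
have E := csum_decr c'j.
apply: runs_bind_step; first by lia.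
apply: runs_bind_step; first by lia.
apply: runs_bind_step; first by lia.
apply: runs_bind_step; first by lia.
apply: runs_weaken (IH _ _ (i :: pre) (j :: post) _ _ _ w'_opt) _ _.
- by rewrite csum_incr; lia.
- by lia.
- by lia.
move=> r [x [y [-> xy yc' gxy]]]; exists (rcons x i), (rcons y j).
have yc'j : counts (rcons y j) = c' by rewrite counts_rcons yc' decrK.
rewrite !cat_rcons !size_rcons xy; split=> // z zc.
rewrite gain_window_rcons // ?yc'j ?zc ?gxy ?subrK ?(window_opt_uniq v_opt w_opt) //.
  by rewrite counts_cons zc.
by rewrite -!csum_counts zc yc' -addnS E.
Qed.

Lemma runs_recover_window (V : window_table R kA) q :
  (forall c c', (csum c + csum c')%N = m -> window_entry c c' (V (c, c'))) ->
  (q <= m)%N ->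
  runs (recover_window m V q) (60 * Z)
    (fun S => exists h y, [/\ S = h ++ y, size h = m, size y = q &
       forall h' y', size h' = m -> size y' = q -> g h' y' <= g h y]).
Proof.
move=> HV qm.
have [l1 l1' l2 l3] := loop_time_le m kA_gt0 kB_gt0; rewrite -/Z in l1 l1' l2 l3.
set P := (m.+1 ^ kA.-1)%N in l1' l2; have P0 : (0 < P)%N by rewrite expn_gt0.
have l4 : (P <= Z)%N by apply: leq_trans l2; rewrite leq_pmulr.
have l5 : (m * kA <= Z)%N by apply: leq_trans l3; nia.
have l6 : (P * P <= Z)%N by apply: leq_trans l1'; rewrite leq_pmulr.
have l7 : (m <= Z)%N by apply: leq_trans l5; rewrite leq_pmulr.
have l8 : (kA <= Z)%N by apply: leq_trans l2; rewrite leq_pmull.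
apply: runs_bind (runs_count_vectors kA_gt0 (leq_subr q m)) _ _; first by lia.
move=> cs [csP size_cs].
apply: runs_bind (runs_count_vectors kA_gt0 qm) _ _; first by lia.
move=> cs' [csP' size_cs'].
have sum_m c c' : c \in cs -> c' \in cs' -> (csum c + csum c')%N = m.
  by move=> /csP -> /csP' ->; rewrite subnK.
apply: (runs_bind (j := (P * (P * (2 * kA + 1).+1 + 1).+1 + 1)%N)).
- apply: runs_maximize; apply: (contributes_for_each (P * (2 * kA + 1).+1 + 1)%N
    (fun c d v => exists2 c', c' \in cs' & d = (c, c') /\ window_opt c c' v)); last first.
    by rewrite leq_add2r leq_mul2r size_cs orbT.
  move=> c c_cs; apply: (contributes_for_each (2 * kA + 1)%N
    (fun c' d v => d = (c, c') /\ window_opt c c' v)); last first.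
    by rewrite leq_add2r leq_mul2r size_cs' orbT.
  move=> c' c'_cs best Q HQ; have [v [d [eV v_opt _]]] := HV c c' (sum_m _ _ c_cs c'_cs).
  apply: runs_bind_step; first by lia.
  rewrite eV; apply: contributes_keep_best HQ; first by lia.
  by move=> d' w; split=> [[-> /(window_opt_uniq v_opt) ->]|[-> ->]].
- rewrite (_ : _ + 1 = 2 * (P * P * kA) + 2 * (P * P) + 2 * P + 1)%N; last ring.
  by lia.
case=> [[v [c c']]|] /= best; last first.
  have [c cm] := ex_counts (m - q); have /csP c_cs := cm.
  have [c' c'q] := ex_counts q; have /csP' c'_cs := c'q.
  have [v [d [_ v_opt _]]] := HV c c' (sum_m _ _ c_cs c'_cs).
  by case: (best (c, c') v); exists c => //; exists c'.
have [[d d_cs [d' d'_cs [[ed ed'] v_opt]]] max] := best; rewrite {best}ed {}ed' in max *.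
have d_q : csum d = (m - q)%N by apply/csP.
have d'_q : csum d' = q by apply/csP'.
apply: runs_bind (runs_listing (leqnn _)) _ _; first by lia.
move=> mid mid_d.
apply: runs_bind (runs_backtrack_window [::] [::] HV (sum_m _ _ d_cs d'_cs) d'_q v_opt) _ _.
  by have := leq_mul qm (leqnn kA); lia.
move=> [pre post] [x [y [[-> ->] xy yc' gxy]]]; rewrite !cats0.
have yq : size y = q by rewrite -csum_counts yc'.
have mid_q : size mid = (m - q)%N by rewrite -csum_counts mid_d.
apply: runs_step; first by have := leq_mul qm (leqnn kA); budget.
exists (x ++ mid), y; rewrite catA size_cat xy yq mid_q subnKC //; split=> //.
(* A competing history is cut after its first [q] actions: the counts of the rest lie in [cs], so
   its payoff is bounded by a cell that the search has examined. *)
move=> h' y' h'm y'q; rewrite -[h'](cat_take_drop q) (gxy _ mid_d).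
have c_cs : counts (drop q h') \in cs by apply/csP; rewrite csum_counts size_drop h'm.
have c'_cs : counts y' \in cs' by apply/csP'; rewrite csum_counts.
have [w [e [_ w_opt _]]] := HV _ _ (sum_m _ _ c_cs c'_cs).
apply: le_trans (max (counts (drop q h'), counts y') w _); last first.
  by exists (counts (drop q h')) => //; exists (counts y').
by case: w_opt => le_w _; apply: le_w; rewrite // size_takel ?h'm.
Qed.

(** ** Schedules *)

Lemma runs_block_payoff (h b : seq 'I_kA) : (size h <= m)%N ->
  runs (block_payoff G f m h b)
    (size b * (kA + 2 * m + (K + 6) * (kA * kB) + 2).+1 + 1)
    (eq (g h b, window m (h ++ b))).
Proof.
move=> hm; apply: runs_weaken (runs_for_each
  (b := (kA + 2 * m + (K + 6) * (kA * kB) + 2)%N)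
  (P := fun ys st => (g h ys, window m (h ++ ys)) = st) _ _ (leqnn _)) _ _ => //.
  by rewrite cats0 window_id.
move=> ys x zs _ _ <-; have gm := size_window m (h ++ ys).
apply: runs_bind_step; first by lia.
apply: runs_bind (runs_round_payoff _ _) _ _; [by rewrite csum_counts|by lia|move=> _ <-].
apply: runs_bind_step; first by lia.
apply: runs_bind_step; first by lia.
apply: runs_ret; rewrite gain_rcons; congr (_, _).
rewrite -(size_rcons _ x) -/(window m (rcons (window m (h ++ ys)) x)).
by rewrite -[rcons (window _ _) x]cats1 window_cat -catA cats1.
Qed.

Lemma expand_rcons (s : schedule kA) r b :
  expand (rcons s (r, b)) = expand s ++ flatten (nseq r b).
Proof. by rewrite /expand map_rcons flatten_rcons. Qed.

(** Justifies continuing after [r + 1] copies with the history left by a single one. *)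
Lemma window_nseq (h b : seq 'I_kA) r : r = 0%N \/ (m <= size b)%N ->
  window m (h ++ flatten (nseq r.+1 b)) = window m (h ++ b).
Proof.
case=> [->|mb]; first by rewrite /= cats0.
rewrite -addn1 nseqD flatten_cat /= cats0 catA.
by rewrite window_catl // [in RHS]window_catl.
Qed.

(** The constant comes from three entries with two evaluated blocks each, every block costing at
    most [(2 * K + 25) * Z]. *)
Lemma runs_schedule_payoff (s : schedule kA) :
  (forall rb, rb \in s ->
     ((rb.1 <= 1)%N \/ (m <= size rb.2)%N) /\ (size rb.2 <= 2 * m)%N) ->
  (size s <= 3)%N ->
  runs (schedule_payoff G f m s) ((12 * K + 169) * Z) (eq (g [::] (expand s))).
Proof.
move=> sP s3.
have [_ _ _ lZ] := loop_time_le m kA_gt0 kB_gt0; rewrite -/Z in lZ.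
have Z0 : (0 < Z)%N by rewrite !muln_gt0 !expn_gt0 kA_gt0 kB_gt0.
have kB1 : (0 < kA * kB)%N by rewrite muln_gt0 kA_gt0.
have lmm : (m.+1 * m.+1 <= Z)%N by apply: leq_trans lZ; rewrite leq_pmulr.
have lm : (m <= Z)%N by apply: leq_trans lmm; nia.
have lmB : (m * (kA * kB) <= Z)%N by apply: leq_trans lZ; rewrite leq_mul2r; nia.
have lmA : (m * kA <= Z)%N.
  by apply: leq_trans lmB; rewrite leq_mul2l leq_pmulr ?orbT.
set bp := (2 * m * (kA + 2 * m + (K + 6) * (kA * kB) + 2).+1 + 1)%N.
have bpZ : (bp <= (2 * K + 25) * Z)%N.
  have -> : bp = (2 * (m * kA) + 4 * (m * m) + 2 * (K + 6) * (m * (kA * kB)) + 6 * m + 1)%N.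
    by rewrite /bp; ring.
  have lmm' : (m * m <= Z)%N by apply: leq_trans lmm; nia.
  by have := leq_mul (leqnn (2 * (K + 6))%N) lmB; lia.
apply: (runs_bind (j := ((12 * K + 169) * Z)%N) (P := fun st =>
    (g [::] (expand s), window m (expand s)) = st)) => //; last first.
  by move=> _ <-; apply: runs_ret.
apply: runs_weaken (runs_for_each (b := (5 + 2 * bp)%N)
  (P := fun ys st => (g [::] (expand ys), window m (expand ys)) = st)
  _ _ (leqnn _)) _ _ => //; last first.
  by nia.
move=> ys [r b] zs _ def <-; have := sP (r, b).
rewrite def mem_cat mem_head orbT => /(_ isT) [/= rm b2m].
have bp_le : (size b * (kA + 2 * m + (K + 6) * (kA * kB) + 2).+1 + 1 <= bp)%N.
  by rewrite leq_add2r leq_mul2r b2m orbT.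
apply: runs_bind_step; first by budget.
rewrite expand_rcons; case: r rm def => [|r] /= rm def.
  by apply: runs_ret; rewrite /= cats0.
apply: runs_bind (runs_block_payoff _ (size_window _ _)) _ _; first by budget.
move=> _ <-; apply: runs_bind (runs_block_payoff _ (size_window _ _)) _ _; first by budget.
move=> _ <-; apply: runs_bind_step; first by budget.
apply: runs_ret; rewrite gain_cat /= !gain_window window_cat.
have rm' : r = 0%N \/ (m <= size b)%N by case: rm => [|->]; [lia | right].
rewrite -/(flatten (nseq r.+1 b)) (window_nseq _ rm') -addrA; congr (_ + _, _).
case: rm' => [->|mb]; first by rewrite /= cats0 mul0r addr0.
by rewrite gain_nseq // gain_catl.
Qed.

(** * Approximation guarantee of the two strategies *)

(** Cut [x] into [r] blocks of length [m] and a last one of length [p]. Each sees only the [m]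
    actions before it, so the bounds [V2] and [Vp] apply. *)
Lemma gain_blocks_le V2 Vp p r h x :
  (forall h y, size h = m -> size y = m -> g h y <= V2) ->
  (forall h y, size h = m -> size y = p -> g h y <= Vp) ->
  (m <= size h)%N -> size x = (r * m + p)%N -> g h x <= r%:R * V2 + Vp.
Proof.
move=> le2 lep; elim: r h x => [|r IH] h x mh xE.
  rewrite mul0r add0r -gain_window; apply: lep => //.
  by rewrite /window size_drop; lia.
rewrite -(cat_take_drop m x) gain_cat -gain_window -natr1 mulrDl mul1r.
have mx : (m <= size x)%N by rewrite xE mulSn -addnA leq_addr.
rewrite addrAC [leLHS]addrC lerD //; last first.
  by apply: le2; [rewrite /window size_drop; lia | rewrite size_takel].
apply: IH; first by rewrite size_cat; lia.
by rewrite size_drop xE mulSn -addnA addKn.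
Qed.

Section OddEven.
Hypothesis u_ge0 : forall a b, 0 <= utilA G a b.

(** Nonnegativity lets the payoff during [z] be discarded, and [z] hides the history [h]. *)
Lemma gain_cat_ge (h z y : seq 'I_kA) : (m <= size z)%N -> g z y <= g h (z ++ y).
Proof. by move=> mz; rewrite gain_cat gain_catl // lerDr gain_ge0. Qed.

Lemma gain_nseq_ge V (b h : seq 'I_kA) r :
  (forall h, V <= g h b) -> r%:R * V <= g h (flatten (nseq r b)).
Proof.
move=> Vb; elim: r h => [|r IH] h; first by rewrite mul0r.
by rewrite /= gain_cat -natr1 mulrDl mul1r addrC lerD.
Qed.

(** Each copy of [S2m] fills two blocks and guarantees [V2]. An odd [r] leaves one block, which
    [Smp] fills together with the last [p] rounds; otherwise [w] adds at least 0. *)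
Lemma fill_blocks_ge V2 Vp (S2m Smp w : seq 'I_kA) p r h :
  size S2m = (2 * m)%N -> size Smp = (m + p)%N -> size w = p ->
  (forall h, V2 <= g h S2m) -> (forall h, Vp <= g h Smp) ->
  let x := expand (result (fill_blocks r S2m Smp w)) in
  size x = (r * m + p)%N /\ (r./2)%:R * V2 + (odd r)%:R * Vp <= g h x.
Proof.
move=> s2 sp sw ge2 gep x.
have -> : x = flatten (nseq r./2 S2m) ++ (if odd r then Smp else w).
  by rewrite /x /expand /= !cats0.
split.
  rewrite size_cat size_flatten /shape map_nseq sumn_nseq s2 -[in RHS](odd_double_half r).
  by rewrite -muln2; case: (odd r); rewrite ?sp ?sw; nia.
rewrite gain_cat lerD ?gain_nseq_ge //.
by case: (odd r); rewrite ?mul1r // mul0r gain_ge0.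
Qed.

Lemma runs_odd_even T (w : seq 'I_kA) : (m <= T)%N -> size w = (T %% m)%N ->
  runs (odd_even G f m T w) ((26 * K + 600) * Z)
    (fun s => size (expand s) = T /\
       2^-1 * OPT G fm m T <= payoff G fm m (expand s)).
Proof.
move=> mT sw; set n := (T %/ m)%N; set p := (T %% m)%N in sw *.
have TE : T = (n * m + p)%N by apply: divn_eq.
have n0 : (0 < n)%N by rewrite divn_gt0.
have pm : (p <= m)%N by rewrite ltnW // ltn_mod.
have Z0 : (0 < Z)%N by rewrite !muln_gt0 !expn_gt0 kA_gt0 kB_gt0.
(* The constant adds [K + 50] and [K + 66] for the dynamic programs, 60 for each recovery,
   [12 * K + 169] for each evaluation, and a few units. *)
rewrite (_ : (26 * K + 600) * Z = 26 * (K * Z) + 600 * Z)%N; last ring.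
apply: runs_bind_step; first by budget.
apply: runs_bind_step; first by budget.
apply: runs_bind runs_compute_Sm _ _; first by budget.
move=> Sm [sm Sm_max].
apply: runs_bind runs_fill_window _ _; first by budget.
move=> V HV.
apply: runs_bind (runs_recover_window HV (leqnn m)) _ _; first by budget.
move=> S2m [h2 [y2 [e2 sh2 sy2 max2]]].
apply: runs_bind (runs_recover_window HV pm) _ _; first by budget.
move=> Smp [hp [yp [ep shp syp maxp]]].
have ge2 h : g h2 y2 <= g h S2m by rewrite e2 gain_cat_ge // sh2.
have gep h : g hp yp <= g h Smp by rewrite ep gain_cat_ge // shp.
have s2 : size S2m = (2 * m)%N by rewrite e2 size_cat sh2 sy2 mul2n addnn.
have sp : size Smp = (m + p)%N by rewrite ep size_cat shp syp.
have fill r h := fill_blocks_ge r h s2 sp sw ge2 gep.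
(* Only [S2m] is ever repeated, and its length [2 * m] is at least [m]. *)
have scheduleP s : s = (n.-1./2, S2m) \/ s = (n./2, S2m) \/ s = (1%N, Sm) \/
    (exists r, s = (1%N, if odd r then Smp else w)) ->
    ((s.1 <= 1)%N \/ (m <= size s.2)%N) /\ (size s.2 <= 2 * m)%N.
  by move=> [|[|[|[r]]]] -> /=; rewrite ?s2 ?sm; [lia|lia|lia|
     case: (odd r); rewrite ?sp ?sw; lia].
apply: (runs_bind (j := 4%N) (P := eq (result (fill_blocks n.-1 S2m Smp w)))) => //.
  by budget.
move=> _ <-; apply: runs_bind_step; first by budget.
set odd_s := _ :: _.
apply: (runs_bind (j := 4%N) (P := eq (result (fill_blocks n S2m Smp w)))) => //.
  by budget.
move=> _ <-; set even_s := result _.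
apply: runs_bind (@runs_schedule_payoff odd_s _ _) _ _ => //.
- move=> rb; rewrite !inE => /or3P[]/eqP->; apply: scheduleP; do ?by [left|right; left|right; right; left].
  by right; right; right; exists n.-1.
- by budget.
move=> _ <-; apply: runs_bind (@runs_schedule_payoff even_s _ _) _ _ => //.
- move=> rb; rewrite !inE => /orP[]/eqP->; apply: scheduleP; do ?by [right; left].
  by right; right; right; exists n.
- by budget.
move=> _ <-; apply: runs_step; first by budget.
have [size_odd ge_odd] := fill n.-1 Sm; have [size_even ge_even] := fill n [::].
have odd_E : expand odd_s = Sm ++ expand (result (fill_blocks n.-1 S2m Smp w)).
  by rewrite /odd_s /expand /= !cats0.
have n1m : (m + (n.-1 * m + p) = T)%N by rewrite addnA -mulSn prednK // -TE.
split.
  case: ifP => _; last by rewrite /even_s size_even -TE.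
  by rewrite odd_E size_cat sm size_odd.
(* The better strategy earns at least half of the sum, so it suffices to bound [OPT] by that sum. *)
have opt_le : OPT G fm m T <= g [::] (expand odd_s) + g [::] (expand even_s).
  apply: bigmax_le => [|x _]; first by apply: addr_ge0; apply: gain_ge0.
  rewrite payoff_gain -(cat_take_drop m x) gain_cat.
  have sx : size (take m x) = m by rewrite size_takel // size_tuple.
  (* Any sequence earns at most the optimum in the first block, [g h2 y2] in each of the other
     [n.-1] blocks and [g hp yp] in the last [p] rounds. *)
  apply: (@le_trans _ _ (g [::] Sm + (n.-1%:R * g h2 y2 + g hp yp))).
    apply: lerD; first exact: Sm_max.
    apply: (gain_blocks_le max2 maxp); first by rewrite /= sx.
    by rewrite size_drop size_tuple -n1m addKn.
  rewrite odd_E gain_cat -addrA lerD2l; apply: le_trans (lerD ge_odd ge_even).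
  rewrite addrACA -!mulrDl -!natrD -[in leLHS](mul1r (g hp yp)).
  (* Together the copies of [S2m] in both strategies account for each block after the first exactly
     once. *)
  rewrite [X in X%:R * g h2 y2 + _ <= _](_ : _ = n.-1./2 + n./2)%N; last first.
    by case: (n) n0 => // n' _ /=; rewrite uphalf_half; have := odd_double_half n'; lia.
  (* Exactly one of [n.-1] and [n] is odd, so [Smp] occurs in one strategy. *)
  rewrite [X in _ <= _ + X%:R * _](_ : _ = 1)%N //.
  by case: (n) n0 => // n' _ /=; case: (odd n').
rewrite payoff_gain mulrC ler_pdivrMr // mulr_natr mulr2n.
apply: le_trans opt_le _.
by case: (leP (g [::] (expand even_s)) (g [::] (expand odd_s))) => [le_eo|/ltW le_oe]; [rewrite lerD2l | rewrite lerD2r].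
Qed.

End OddEven.
End DynamicPrograms.

(* K is the constant of the O(kA kB) bound on evaluating the learning rule, and
   C the constant of the running time; w lists the arbitrary actions. *)
Theorem theorem4 (K : nat) :
  exists C : nat,
  forall (R : realType) (kA kB : nat) (G : game R kA kB) (H : R) (m T : nat)
         (f : countvec kA -> timed (mixed R kB)) (w : seq 'I_kA),
    (0 < kA)%N -> (0 < m)%N -> (m < T)%N ->
    (forall a b, 0 <= utilA G a b <= H) ->
    (forall c, (csum c <= m)%N -> (time (f c) <= K * (kA * kB))%N) ->
    size w = (T %% m)%N ->
    let fm := fun c => result (f c) in
    let run := odd_even G f m T w in
    let x := expand (result run) in
    [/\ size x = T,
        2^-1 * OPT G fm m T <= payoff G fm m x &
        (time run <= C * (kB * kA ^ 3 * (m + 2 * kA) ^ (2 * kA)))%N].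
Proof.
exists (26 * K + 600)%N => R kA kB G H m T f w kA0 m0 mT uH f_time sw fm run x.
(* The weights of a mixed action sum to 1, which is impossible over no actions. *)
have kB0 : (0 < kB)%N.
  have := mixed_sum1 (result (f (zerov kA))); case: kB G f {H uH f_time fm run x} => // G f.
  by rewrite big_ord0 => /esym/eqP; rewrite oner_eq0.
have u0 a b : 0 <= utilA G a b by have /andP[] := uH a b.
have [time_run [size_x opt_x]] := runs_odd_even kA0 kB0 m0 f_time u0 (ltnW mT) sw.
split=> //; apply: leq_trans time_run _.
(* [m + 1 <= m + 2 * kA] because [kA > 0]. *)
by rewrite !leq_mul2l; apply/orP; right; apply/orP; right; apply: leq_expnl; lia.
Qed.
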